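(* Let $\mathbb A$ be an algebra on $\mathbb R^n$, let $U\subset\mathbb R^k$ be a simply-connected open set, let $\varphi:U\to\mathbb R^n$ be a $C^2$-function and let $f:U\to\mathbb R^n$ be a $\varphi\mathbb A$-differentiable function. If $\gamma:[0,t_1]\to U$ is a closed differentiable path contained in $U$, then its $\varphi\mathbb A$-line integral vanishes: $$\int_\gamma f\,d\varphi=\int_0^{t_1} f(\gamma(s))\,d\varphi_{\gamma(s)}(\gamma'(s))\,ds=0.$$
   Context: An algebra $\mathbb A$ on $\mathbb R^n$ is the real linear space $\mathbb R^n$ with a bilinear, associative, commutative product having a unit $e$. For functions $f,\varphi:U\subset\mathbb R^k\to\mathbb R^n$ on an open set $U$, both differentiable in the usual sense, $f$ is $\varphi\mathbb A$-differentiable on $U$ if there is a function $f'_\varphi:U\to\mathbb R^n$ such that $df_u(\xi)=f'_\varphi(u)\,d\varphi_u(\xi)$ for all $u\in U$, $\xi\in\mathbb R^k$, where the right side is the $\mathbb A$-product of $f'_\varphi(u)$ and $d\varphi_u(\xi)$ and $df$, $d\varphi$ are usual differentials. In the $\varphi\mathbb A$-line integral, $f(\gamma(s))\,d\varphi_{\gamma(s)}(\gamma'(s))$ is an $\mathbb A$-product, and the integral over $s$ is the usual integral of an $\mathbb R^n$-valued function. *)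

(* Defs.v *)
From HB Require Import structures.
From mathcomp Require Import all_boot all_order all_algebra.
From mathcomp Require Import all_classical all_reals all_analysis.

Set Implicit Arguments.
Unset Strict Implicit.
Unset Printing Implicit Defensive.

Import Order.TTheory GRing.Theory Num.Theory.
Import numFieldNormedType.Exports.

Local Open Scope classical_set_scope.
Local Open Scope ring_scope.

Record algebra_on (R : realType) (n : nat) := AlgebraOn {
  amul : 'rV[R]_n -> 'rV[R]_n -> 'rV[R]_n ;
  aunit : 'rV[R]_n ;
  amul_linear_l : forall b, linear (fun a => amul a b) ;
  amul_linear_r : forall a, linear (amul a) ;
  amulA : associative amul ;
  amulC : commutative amul ;
  amul1 : left_id aunit amul }.

Section Differentiability.
Variables (R : realType) (k n : nat) (U : set 'rV[R]_k).

(* Functions U -> R^n are represented by total functions on R^k.  They are only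
   constrained on U, which is open wherever these notions are used, so that the
   differentials below depend on the values on U alone. *)

(* In finite dimension, u |-> 'd g u is C^m as a map into the space of linear
   maps iff u |-> 'd g u v is C^m for every fixed vector v. *)
Fixpoint Ck_on (m : nat) (g : 'rV[R]_k -> 'rV[R]_n) : Prop :=
  match m with
  | 0 => forall u, U u -> {for u, continuous g}
  | m'.+1 => (forall u, U u -> differentiable g u) /\
             (forall v, Ck_on m' (fun u => 'd g u v))
  end.

Definition phiA_differentiable (A : algebra_on R n)
    (phi f : 'rV[R]_k -> 'rV[R]_n) : Prop :=
  [/\ forall u, U u -> differentiable f u,
      forall u, U u -> differentiable phi u &
      exists f' : 'rV[R]_k -> 'rV[R]_n,
        forall u xi, U u -> 'd f u xi = amul A (f' u) ('d phi u xi)].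

End Differentiability.

Section SimplyConnected.
Variables (R : realType) (T : topologicalType).

Definition path_connected (U : set T) : Prop :=
  forall x y, U x -> U y -> exists c : R -> T,
    [/\ {within `[0, 1], continuous c}, c @` `[0, 1] `<=` U, c 0 = x & c 1 = y].

Definition null_homotopic (U : set T) (c : R -> T) : Prop :=
  exists H : R * R -> T,
    [/\ {within `[0, 1] `*` `[0, 1], continuous H},
        H @` (`[0, 1] `*` `[0, 1]) `<=` U,
        forall s, s \in `[0, 1] -> H (s, 0) = c s,
        forall s, s \in `[0, 1] -> H (s, 1) = c 0 &
        forall t, t \in `[0, 1] -> H (0, t) = c 0 /\ H (1, t) = c 0].

Definition simply_connected (U : set T) : Prop :=
  path_connected U /\
  forall c : R -> T, {within `[0, 1], continuous c} ->
    c @` `[0, 1] `<=` U -> c 0 = c 1 -> null_homotopic U c.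

End SimplyConnected.

Section Paths.
Variables (R : realType) (k n : nat) (t1 : R).

(* A path on [0, t1] is represented by a total function on R, constrained on
   [0, t1] only: the difference quotients are restricted to points of the
   interval, so that the derivatives at 0 and t1 are one-sided. *)
Definition path_quotient (gamma : R -> 'rV[R]_k) (s : R) :=
  (fun h => h^-1 *: (gamma (s + h) - gamma s)) @
    within (fun h => s + h \in `[0, t1]) 0^'.

Definition path_differentiable (gamma : R -> 'rV[R]_k) : Prop :=
  forall s, s \in `[0, t1] -> cvg (path_quotient gamma s).

Definition path_derivative (gamma : R -> 'rV[R]_k) (s : R) : 'rV[R]_k :=
  lim (path_quotient gamma s).

Variables (A : algebra_on R n) (phi f : 'rV[R]_k -> 'rV[R]_n).

Definition line_integrand (gamma : R -> 'rV[R]_k) (s : R) : 'rV[R]_n :=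
  amul A (f (gamma s)) ('d phi (gamma s) (path_derivative gamma s)).

Definition line_integrable (gamma : R -> 'rV[R]_k) : Prop :=
  forall i : 'I_n, (@lebesgue_measure R).-integrable `[0, t1]
    (fun s => (line_integrand gamma s ord0 i)%:E).

Definition line_integral (gamma : R -> 'rV[R]_k) : 'rV[R]_n :=
  \row_(i < n)
    \int[@lebesgue_measure R]_(s in `[0, t1]) line_integrand gamma s ord0 i.

End Paths.

(* Main.v *)
(** Fix a component [w] of the form [f dphi].  At a point [p], with
    [L = 'd phi p] and [c = f' p], the function
    [G u = f p * phi u + c * (L (u - p))^2 / 2] satisfies
    ['d G u - w u = o(|u - p|)]: the quadratic term is an antiderivative of
    [c * L (u - p) * L], because the product is commutative and associative.
    No continuity of [f'] and no second derivative of [phi] enters.  Goursat's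
    bisection of triangles then shows that the integral of [w] around a small
    triangle vanishes.  Subdividing the square of a null-homotopy into small
    cells, the sum of the integrals of [w] over the chords of the loop is
    unchanged from one row of the grid to the next, so it vanishes.  Along each
    piece of the loop, the integral of [w] over the chord from the start of the
    piece is a function differentiable everywhere whose derivative is the line
    integrand; as the integrand is only Lebesgue integrable, the last step is
    the fundamental theorem of calculus for everywhere differentiable functions
    with integrable derivative. *)

Require Import Defs.
From HB Require Import structures.
From mathcomp Require Import all_boot all_order all_algebra.
From mathcomp Require Import all_classical all_reals all_analysis.
From mathcomp Require Import measurable_realfun ring lra.

Set Implicit Arguments.
Unset Strict Implicit.
Unset Printing Implicit Defensive.

Import Order.TTheory GRing.Theory Num.Theory.
Import numFieldNormedType.Exports.

Local Open Scope classical_set_scope.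
Local Open Scope ring_scope.

(** * The fundamental theorem of calculus for integrable derivatives *)

(** Cousin's lemma as an induction over intervals: the supremum of the points reached from [a] is
    itself reached, by the local hypothesis at that point, and the same hypothesis would reach
    further if it lay before [b]. *)
Lemma interval_cousin (R : realType) (P : R -> R -> Prop) (a b : R) :
  a <= b ->
  (forall x y z, x <= y -> y <= z -> P x y -> P y z -> P x z) ->
  (forall s, a <= s -> s <= b -> exists2 d, 0 < d &
     forall x y, a <= x -> x <= s -> s <= y -> y <= b ->
       s - x < d -> y - s < d -> P x y) ->
  P a b.
Proof.
move=> ab Padd Ploc.
pose S := [set x | a <= x <= b /\ P a x].
have Sa : S a.
  split; first by rewrite lexx ab.
  by have [d d0 H] := Ploc a (lexx _) ab; apply: H; rewrite ?lexx ?subrr.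
have ubS : ubound S b by move=> x [/andP[_ ?] _].
have hS : has_sup S by split; [exists a | exists b].
pose s := sup S.
have as_ : a <= s by apply: ub_le_sup => //; exists b.
have sb : s <= b by apply: ge_sup => //; exists a.
have [d d0 H] := Ploc s as_ sb.
have [x [/andP[ax xb] Pax] sx] := sup_adherent d0 hS.
have xs : x <= s by apply: ub_le_sup => //; [exists b | split => //; rewrite ax xb].
have Pas : P a s.
  apply: (Padd a x s) => //; apply: H => //; last by rewrite subrr.
  by move: sx; rewrite -/s; lra.
have [/eqP <-//|nsb] := boolP (s == b).
have {}sb : s < b by rewrite lt_neqAle nsb.
(* A point beyond the supremum, still in [[a, b]] and within the radius [d] of [s]. *)
pose y := Num.min b (s + d / 2).
have sy : s < y by rewrite lt_min sb /=; lra.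
have yb : y <= b by rewrite ge_min lexx.
have yd : y - s < d.
  have : y <= s + d / 2 by rewrite ge_min lexx orbT.
  by lra.
suff : y <= s by rewrite leNgt sy.
apply: ub_le_sup; first by exists b.
split; first by rewrite (le_trans as_ (ltW sy)) yb.
apply: (Padd a s y) => //; first exact: ltW.
by apply: H => //; [exact: ltW | rewrite subrr].
Qed.

(** The estimate adds up over adjacent intervals, and an interval around a point [s] splits at [s].
    Cousin's lemma then does without uniformity of [d] in [s]. *)
Lemma locally_lipschitz_le (R : realType) (F : R -> R) (a b C : R) :
  a <= b ->
  (forall s, a <= s -> s <= b -> exists2 d, 0 < d &
     forall y, a <= y -> y <= b -> `|y - s| < d ->
       `|F y - F s| <= C * `|y - s|) ->
  `|F b - F a| <= C * (b - a).
Proof.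
move=> ab Floc.
apply: (@interval_cousin _ (fun x y => `|F y - F x| <= C * (y - x)) _ _ ab).
  move=> x y z xy yz H1 H2.
  rewrite (_ : F z - F x = (F z - F y) + (F y - F x)); last by ring.
  by rewrite (le_trans (ler_normD _ _))//; lra.
move=> s as_ sb; have [d d0 H] := Floc s as_ sb; exists d => // x y ax xs sy yb sx ys.
have H1 := H x ax (le_trans xs sb); rewrite distrC [`|F x - _|]distrC in H1.
have H2 := H y (le_trans as_ sy) yb.
rewrite ger0_norm in H1; last by rewrite subr_ge0.
rewrite ger0_norm in H2; last by rewrite subr_ge0.
rewrite (_ : F y - F x = (F y - F s) + (F s - F x)); last by ring.
by rewrite (le_trans (ler_normD _ _))//; have := H1 sx; have := H2 ys; lra.
Qed.

(* The level sets [E j] of [h] at scale [e] are covered by open sets [G j] of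
   nearly the same measure.  The set function [nu], the sum of [(j + 1) e] times
   the measure of the trace on [G j], exceeds the increments of [F] on small
   intervals because [G j] is open, and exceeds the integral of [h] by little. *)
Lemma ge0_le_lebesgue_integral_upper_deriv (R : realType) (F h : R -> R)
    (a b : R) : a <= b ->
  (forall x, 0 <= h x) -> measurable_fun `[a, b] h ->
  (forall s c, a <= s -> s <= b -> h s < c -> exists2 d, 0 < d &
     forall x y, a <= x -> x <= s -> s <= y -> y <= b ->
       s - x < d -> y - s < d -> F y - F x <= c * (y - x)) ->
  ((F b - F a)%:E <= \int[@lebesgue_measure R]_(x in `[a, b]) (h x)%:E)%E.
Proof.
move=> ab h0 mh Floc; set mu := @lebesgue_measure R.
have muab : mu `[a, b]%classic = (b - a)%:E.
  by rewrite /mu lebesgue_measure_itv/= lte_fin; case: ltP => // ba;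
    rewrite (@le_anti _ _ a b) ?ab ?ba // subrr.
apply/lee_addgt0Pr => e0 e00.
(* Rounding [h] up to a multiple of [e] costs at most [e * (b - a)] and the passage to open sets
   costs at most [e], in total [e0]. *)
pose e := e0 / (b - a + 1).
have ba1 : 0 < b - a + 1 by lra.
have e_gt0 : 0 < e by rewrite divr_gt0.
have ee : e * (b - a) + e = e0 by rewrite -[X in _ + X]mulr1 -mulrDr /e divfK // gt_eqF.
pose E j := `[a, b]%classic `&` h @^-1` `[j%:R * e, j.+1%:R * e[%classic.
have mE j : measurable (E j) by apply: mh => //; exact: measurable_itv.
have muE j : (mu (E j) < +oo)%E.
  apply: (@le_lt_trans _ _ (mu `[a, b]%classic)).
    by apply: le_measure; rewrite ?inE; [exact: mE| exact: measurable_itv|move=> ? []].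
  by rewrite muab ltry.
have tE : trivIset setT E.
  apply/trivIsetP => i j _ _ ij; rewrite -subset0 => x [[_ /=]].
  rewrite in_itv /= => /andP[i1 i2] [_ /=]; rewrite in_itv /= => /andP[j1 j2].
  have := le_lt_trans i1 j2; rewrite ltr_pM2r // ltr_nat ltnS => ij1.
  have := le_lt_trans j1 i2; rewrite ltr_pM2r // ltr_nat ltnS => ij2.
  by move/eqP: ij; apply; apply/eqP; rewrite eqn_leq ij1.
have abE : `[a, b]%classic = \bigcup_j E j.
  apply/seteqP; split => [x xab|x [j _ []//]].
  exists (Num.truncn (h x / e)) => //; split => //=.
  have /truncn_itv : 0 <= h x / e by rewrite divr_ge0 // ltW.
  by rewrite in_itv /= ler_pdivlMr // ltr_pdivrMr.
(* The measure allowed to [G j] beyond [E j] is divided by the weight of [G j] in [nu], so that the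
   weighted excesses sum to at most [e]. *)
have d0 j : 0 < e / (2 ^ j.+1)%:R / (j.+1%:R * e) :> R.
  apply: divr_gt0; last exact: mulr_gt0.
  by apply: divr_gt0 => //; rewrite ltr0n expn_gt0.
have /choice[G HG] j := lebesgue_regularity_outer (mE j) (muE j) (d0 j).
have oG j : measurable (G j) by apply: open_measurable; case: (HG j).
have c0 j : 0 <= j.+1%:R * e by rewrite mulr_ge0 // ltW.
pose nu I := (\sum_(j <oo) (j.+1%:R * e)%:E * mu (I `&` G j))%E.
have nu0 I j : (0 <= (j.+1%:R * e)%:E * mu (I `&` G j))%E.
  by rewrite mule_ge0 // lee_fin.
have nuab : ((F b - F a)%:E <= nu `]a, b]%classic)%E.
  apply: (@interval_cousin _ (fun x y => ((F y - F x)%:E <= nu `]x, y]%classic)%E) _ _ ab).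
    move=> x y z xy yz H1 H2.
    have -> : nu `]x, z]%classic = (nu `]x, y]%classic + nu `]y, z]%classic)%E.
      rewrite /nu -nneseriesD //; apply: eq_eseriesr => j _.
      rewrite -muleDr // ?ge0_adde_def ?inE //; congr (_ * _)%E.
      rewrite -measureU; first last.
      - rewrite -subset0 => t /= [[+ _] [+ _]]; rewrite !in_itv /=.
        by move=> /andP[_ ty] /andP[yt _]; move: yt; rewrite ltNge ty.
      - by apply: measurableI; [exact: measurable_itv|exact: oG].
      - by apply: measurableI; [exact: measurable_itv|exact: oG].
      rewrite -setIUl; congr (mu (_ `&` _)).
      by rewrite -itv_bndbnd_setU // bnd_simp.
    rewrite (_ : F z - F x = (F y - F x) + (F z - F y)); last by ring.
    by rewrite EFinD leeD.
  move=> s as_ sb.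
  have : `[a, b]%classic s by rewrite /= in_itv /= as_ sb.
  rewrite abE => -[j _ Ejs].
  have hs : h s < j.+1%:R * e by case: Ejs => _ /=; rewrite in_itv /= => /andP[].
  have [d d_gt0 Hd] := Floc _ _ as_ sb hs.
  have [oGj EG _] := HG j.
  (* A short interval around [s] lies entirely in [G j], so the single term of index [j] in [nu]
     already bounds the increment of [F]. *)
  have /(open_nbhs_nbhs) : open_nbhs s (G j) by split => //; exact: EG.
  rewrite -nbhs_ballE => -[r /= r0 rG].
  exists (Num.min d r); first by rewrite lt_min d_gt0.
  move=> x y ax xs sy yb; rewrite !lt_min => /andP[sx1 sx2] /andP[ys1 ys2].
  apply: (@le_trans _ _ ((j.+1%:R * e)%:E * mu (`]x, y]%classic `&` G j))%E).
    have -> : `]x, y]%classic `&` G j = `]x, y]%classic.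
      apply/setIidPl => t /=; rewrite in_itv /= => /andP[xt ty].
      by apply: rG; rewrite /ball /= ltr_norml; lra.
    rewrite /mu lebesgue_measure_itv /= lte_fin; case: ltP => xy.
      by rewrite -EFinM lee_fin; apply: Hd.
    have -> : x = y by lra.
    by rewrite subrr mule0.
  rewrite /nu; apply: le_trans (nneseries_lim_ge j.+1 _) => //.
  by rewrite big_nat_recr //= leeDr // sume_ge0.
apply: (le_trans nuab).
apply: (@le_trans _ _ (\sum_(j <oo) ((\int[mu]_(x in E j) (h x + e)%:E) + (e / (2 ^ j.+1)%:R)%:E))%E).
  apply: lee_nneseries => // j _.
  have [oGj EG HGj] := HG j.
  apply: (@le_trans _ _ ((j.+1%:R * e)%:E * (mu (E j) + (e / (2 ^ j.+1)%:R / (j.+1%:R * e))%:E))%E).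
    rewrite lee_wpmul2l ?lee_fin //.
    apply: (@le_trans _ _ (mu (E j `|` (G j `\` E j)))).
      apply: le_measure; rewrite ?inE.
      - by apply: measurableI; [exact: measurable_itv|exact: oG].
      - by apply: measurableU; [exact: mE|apply: measurableD; [exact: oG|exact: mE]].
      move=> t [_ Gt]; have [Et|nEt] := pselect (E j t); [by left|by right].
    rewrite /mu measureU; first by rewrite leeD2l // ltW.
    - exact: mE.
    - by apply: measurableD; [exact: oG|exact: mE].
    - exact: setDIK.
  rewrite muleDr ?ge0_adde_def ?inE // ?lee_fin; last by rewrite ltW.
  rewrite -EFinM (mulrC (j.+1%:R * e)) divfK; last by rewrite gt_eqF // mulr_gt0.
  rewrite leeD2r // -integral_cst //=; last exact: mE.
  apply: ge0_le_integral => /=.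
  - exact: mE.
  - by move=> x _; rewrite lee_fin.
  - exact: measurable_cst.
  - apply/measurable_EFinP; apply: measurable_funD => //.
    by apply: measurable_funS mh => //; exact: subIsetl.
  move=> x [_ /=]; rewrite in_itv /= => /andP[H _]; rewrite lee_fin.
  by rewrite -natr1 mulrDl mul1r lerD2r.
apply: le_trans (epsilon_trick _ _ (ltW e_gt0)) _ => //.
  by move=> j; apply: integral_ge0 => x _; rewrite lee_fin addr_ge0 // ltW.
have mhe : measurable_fun `[a, b] (fun x => (h x + e)%:E).
  by apply/measurable_EFinP; apply: measurable_funD.
rewrite -ge0_integral_bigcup //= -?abE //; last first.
  by move=> x _; rewrite lee_fin addr_ge0 // ltW.
under eq_integral do rewrite EFinD.
rewrite ge0_integralD //=; last 3 first.
- by move=> x _; rewrite lee_fin.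
- exact/measurable_EFinP.
- by move=> x _; rewrite lee_fin ltW.
rewrite [X in (_ + X + _ <= _)%E](integral_cst mu) //= [lebesgue_measure _]muab -EFinM -addeA -EFinD ee.
by [].
Qed.

Definition has_derivative_on (R : realType) (a b : R) (F g : R -> R) : Prop :=
  forall s, a <= s -> s <= b -> forall e, 0 < e -> exists2 d, 0 < d &
    forall y, a <= y -> y <= b -> `|y - s| < d ->
      `|F y - F s - g s * (y - s)| <= e * `|y - s|.

Lemma integrable_cst_itv (R : realType) (a b c : R) :
  (@lebesgue_measure R).-integrable `[a, b] (EFin \o cst c).
Proof.
apply: continuous_compact_integrable; first exact: segment_compact.
by apply: continuous_subspaceT => x; exact: cst_continuous.
Qed.

Lemma Rintegral_cst_itv (R : realType) (a b c : R) : a <= b ->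
  \int[@lebesgue_measure R]_(x in `[a, b]) c = c * (b - a).
Proof.
move=> ab; rewrite Rintegral_cst //= lebesgue_measure_itv /= lte_fin.
by case: ltP => // ba; rewrite (@le_anti _ _ a b) ?ab ?ba // subrr.
Qed.

(* Truncation from below at [- n] and translation by [n] reduce the statement to
   a nonnegative bound of the derivative. *)
Lemma le_Rintegral_derivative (R : realType) (F g : R -> R) (a b : R) :
  a <= b -> (@lebesgue_measure R).-integrable `[a, b] (EFin \o g) ->
  has_derivative_on a b F g ->
  F b - F a <= \int[@lebesgue_measure R]_(x in `[a, b]) g x.
Proof.
move=> ab ig dF; set mu := @lebesgue_measure R.
have mg : measurable_fun `[a, b] g.
  by apply/measurable_EFinP; exact: measurable_int ig.
pose m n x := Num.max (g x) (- n%:R).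
have mm n : measurable_fun `[a, b] (m n) by exact: measurable_maxr.
have m_norm n x : `|m n x| <= `|g x|.
  rewrite /m; case: (leP (g x) (- n%:R)) => [H|_ //]; have n0 : 0 <= n%:R :> R by [].
  by rewrite normrN (ger0_norm n0) ler0_norm; lra.
have im n : mu.-integrable `[a, b] (EFin \o m n).
  apply: le_integrable ig; first exact: measurable_itv.
    by apply/measurable_EFinP; exact: mm.
  by move=> x _; rewrite /= lee_fin m_norm.
have key n : F b - F a <= \int[mu]_(x in `[a, b]) m n x.
  (* Adding [n x] to [F] makes the bound nonnegative and adds [n (b - a)] to both sides, which
     cancels at the end. *)
  have := @ge0_le_lebesgue_integral_upper_deriv R (fun x => F x + n%:R * x)
    (fun x => m n x + n%:R) a b ab.
  have h0 x : 0 <= m n x + n%:R.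
    by rewrite -[X in _ + X]opprK subr_ge0 le_max lexx orbT.
  move=> /(_ h0 (measurable_funD (mm n) (@measurable_cst _ _ _ _ _ _))) H.
  have {}H := H _.
  have : ((F b + n%:R * b - (F a + n%:R * a))%:E <=
          \int[mu]_(x in `[a, b]) (m n x + n%:R)%:E)%E.
    apply: H => s c as_ sb hc.
    have gm : g s <= m n s by rewrite le_max lexx.
    have e0 : 0 < c - n%:R - g s by lra.
    have [d d0 Hd] := dF s as_ sb _ e0; exists d => // x y ax xs sy yb sx ys.
    have := Hd x ax (le_trans xs sb); have := Hd y (le_trans as_ sy) yb.
    rewrite (ger0_norm (_ : 0 <= y - s)) ?subr_ge0 // => /(_ ys).
    rewrite (ler0_norm (_ : x - s <= 0)) ?subr_le0 // opprB => + /(_ sx).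
    by rewrite !ler_norml; nra.
  rewrite -[X in (_ <= X)%E]fineK; last first.
    apply: integrable_fin_num => //.
    by apply: (integrableD _ (im n) (integrable_cst_itv _ _ n%:R)).
  rewrite lee_fin -/(Rintegral mu _ _) RintegralD //; last exact: integrable_cst_itv.
  by rewrite Rintegral_cst_itv //; lra.
(* At each point [m n] equals [g] from some rank on, and [|g|] dominates all the [m n]. *)
have [] := @dominated_convergence _ _ _ (@lebesgue_measure R) `[a, b]%classic
    (measurable_itv _) (fun n => EFin \o m n) (EFin \o g) (abse \o (EFin \o g)).
  - by move=> n; apply/measurable_EFinP; exact: mm.
  - by apply/measurable_EFinP; exact: mg.
  - apply: aeW => x _; apply: cvg_near_cst.
    have := nbhs_infty_ger `|g x|; apply: filterS => n Hn /=; congr (_%:E).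
    by apply/max_idPl; rewrite lerNl (le_trans _ Hn) // -normrN ler_norm.
  - exact: integrable_abse.
  - by apply: aeW => x n _; rewrite /= lee_fin.
move=> _ _ cv; rewrite -lee_fin /Rintegral fineK; last exact: integrable_fin_num.
apply: cvge_ge cv; apply: nearW => n /=.
rewrite -[X in (_ <= X)%E]fineK ?lee_fin; first exact: key.
by apply: integrable_fin_num; [exact: measurable_itv|exact: im].
Qed.

Lemma Rintegral_derivative (R : realType) (F g : R -> R) (a b : R) :
  a <= b -> (@lebesgue_measure R).-integrable `[a, b] (EFin \o g) ->
  has_derivative_on a b F g ->
  \int[@lebesgue_measure R]_(x in `[a, b]) g x = F b - F a.
Proof.
move=> ab ig dF; apply/le_anti/andP; split; last exact: le_Rintegral_derivative.
(* The opposite inequality is the previous lemma applied to [- F] and [- g]. *)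
have : - F b - - F a <= \int[@lebesgue_measure R]_(x in `[a, b]) (-1 * g x).
  apply: (@le_Rintegral_derivative R (fun x => - F x)) => //.
    by apply: eq_integrable (integrableN ig) => // x _ /=; rewrite mulN1r.
  move=> s as_ sb e e0; have [d d0 H] := dF s as_ sb e e0; exists d => // y ay yb ys.
  rewrite (_ : - F y - _ - _ = - (F y - F s - g s * (y - s))); last by ring.
  by rewrite normrN H.
by rewrite RintegralZl //; lra.
Qed.

Lemma within_continuous_itvP (R : realType) (V : normedModType R) (a b : R)
    (g : R -> V) :
  {within `[a, b], continuous g} <->
  forall s, a <= s -> s <= b -> forall e, 0 < e -> exists2 d, 0 < d &
    forall y, a <= y -> y <= b -> `|y - s| < d -> `|g y - g s| < e.
Proof.
split=> [/subspace_continuousP gc s as_ sb e e0|gc].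
  have sab : `[a, b]%classic s by rewrite /= in_itv /= as_ sb.
  move/cvgrPdist_lt : (gc s sab) => /(_ e e0).
  rewrite /within /= => /nbhs_ballP[d /= d0 H]; exists d => // y ay yb ys.
  rewrite distrC; apply: H => //=; last by rewrite in_itv /= ay yb.
  by rewrite /ball /= distrC.
apply/subspace_continuousP => s; rewrite /= in_itv /= => /andP[as_ sb].
apply/cvgrPdist_lt => e e0; have [d d0 H] := gc s as_ sb e e0.
rewrite /within /=; apply/nbhs_ballP; exists d => //= y.
rewrite /ball /= in_itv /= => ys /andP[ay yb].
by rewrite distrC H // distrC.
Qed.

(** On a short interval ending at [s] the integrand stays within [e] of [g s]; [est] integrates this
    bound and serves on both sides of [s], hence also at the ends of [[a, b]]. *)
Lemma has_derivative_on_Rintegral (R : realType) (a b : R) (g : R -> R) :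
  {within `[a, b], continuous g} ->
  has_derivative_on a b (fun x => \int[@lebesgue_measure R]_(t in `[a, x]) g t) g.
Proof.
move=> gc; set mu := @lebesgue_measure R.
have ig x y : a <= x -> y <= b -> mu.-integrable `[x, y] (EFin \o g).
  move=> ax yb; apply: continuous_compact_integrable; first exact: segment_compact.
  by apply: continuous_subspaceW gc; apply: subset_itv; rewrite bnd_simp.
have est x y c e : a <= x -> x <= y -> y <= b ->
    (forall t, x <= t -> t <= y -> `|g t - c| <= e) ->
    `|\int[mu]_(t in `[a, y]) g t - \int[mu]_(t in `[a, x]) g t - c * (y - x)|
      <= e * (y - x).
  move=> ax xy yb H.
  rewrite Rintegral_itvB ?bnd_simp //; last exact: ig.
  rewrite Rintegral_itv_obnd_cbnd; last first.
    by apply: integrableS (ig x y ax yb) => //; exact: subset_itv_oc_cc.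
  rewrite -Rintegral_cst_itv // -RintegralB //; last 2 first.
  - exact: ig.
  - exact: integrable_cst_itv.
  have igc : mu.-integrable `[x, y] (EFin \o (fun t => g t - c)).
    by apply: (integrableB _ (ig x y ax yb) (integrable_cst_itv _ _ c)).
  apply: (le_trans (le_normr_Rintegral _ igc)) => //.
  rewrite -Rintegral_cst_itv //; apply: le_Rintegral => //.
  - exact: (integrable_norm igc).
  - exact: integrable_cst_itv.
  - by move=> t; rewrite /= in_itv /= => /andP[xt ty]; exact: H.
move/within_continuous_itvP : gc => gc s as_ sb e e0.
have [d d0 H] := gc s as_ sb e e0; exists d => // y ay yb.
have [sy|ys] := leP s y.
  rewrite ger0_norm ?subr_ge0 // => ysd; apply: est => // t st ty.
  by apply: ltW; apply: H; rewrite ?ger0_norm; lra.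
rewrite ltr0_norm ?subr_lt0 // opprB => ysd.
rewrite -normrN !opprB [X in `|X|](_ : _ =
  \int[mu]_(t in `[a, s]) g t - \int[mu]_(t in `[a, y]) g t - g s * (s - y)).
  apply: est => // [|t yt ts]; first exact: ltW.
  by apply: ltW; apply: H; rewrite ?ler0_norm; lra.
by ring.
Qed.

(** * Integrals of forms along segments *)

Definition segment_point (R : realType) (V : normedModType R) (p q : V) (t : R) : V :=
  p + t *: (q - p).

Definition segment_integral (R : realType) (V : normedModType R)
    (w : V -> V -> R) (p q : V) : R :=
  \int[@lebesgue_measure R]_(t in `[0, 1]) w (segment_point p q t) (q - p).

(** A field of linear functionals, bounded at the points of [U] and continuous there in operator
    norm; the norm is spelled out as an estimate uniform in [v]. *)
Definition continuous_form_on (R : realType) (V : normedModType R)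
    (U : set V) (w : V -> V -> R) : Prop :=
  [/\ forall u c v v', w u (c *: v + v') = c * w u v + w u v',
      forall p, U p -> exists M, forall v, `|w p v| <= M * `|v| &
      forall p, U p -> forall e, 0 < e -> exists2 d, 0 < d &
        forall u, `|u - p| < d -> forall v, `|w u v - w p v| <= e * `|v|].

(* Closedness of a form that need not be C^1: near each point, the form is the
   differential of a function up to an error that is infinitesimal relative to
   the distance to that point.  This is all that the bisection argument of
   Goursat uses. *)
Definition closed_form_on (R : realType) (V : normedModType R)
    (U : set V) (w : V -> V -> R) : Prop :=
  forall p, U p -> forall e, 0 < e -> exists2 d, 0 < d &
    exists G : V -> R, forall u, `|u - p| < d -> forall h, 0 < h ->
      exists2 d', 0 < d' & forall v, `|v| < d' ->
        `|G (u + v) - G u - w u v| <= (e * `|u - p| + h) * `|v|.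

Lemma continuous_formB (R : realType) (V : normedModType R) (U : set V)
    (w : V -> V -> R) (u x y : V) :
  continuous_form_on U w -> w u (x - y) = w u x - w u y.
Proof.
move=> [wl _ _]; have := wl u (-1) y x.
by rewrite scaleN1r [- y + x]addrC => ->; ring.
Qed.

Lemma continuous_formZ (R : realType) (V : normedModType R) (U : set V)
    (w : V -> V -> R) (u x : V) (c : R) :
  continuous_form_on U w -> w u (c *: x) = c * w u x.
Proof.
move=> wU; have w0 : w u 0 = 0 by rewrite -(subrr x) (continuous_formB _ _ _ wU) subrr.
by rewrite -[c *: x]addr0; case: wU => -> _ _; rewrite w0 addr0.
Qed.

Lemma continuous_form0 (R : realType) (V : normedModType R) (U : set V)
    (w : V -> V -> R) (u : V) :
  continuous_form_on U w -> w u 0 = 0.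
Proof. by move=> wU; rewrite -(scale0r u) (continuous_formZ _ _ _ wU) mul0r. Qed.

Lemma segment_point0 (R : realType) (V : normedModType R) (p q : V) :
  segment_point p q 0 = p.
Proof. by rewrite /segment_point scale0r addr0. Qed.

Lemma segment_point1 (R : realType) (V : normedModType R) (p q : V) :
  segment_point p q 1 = q.
Proof. by rewrite /segment_point scale1r addrC subrK. Qed.

Lemma segment_pointB (R : realType) (V : normedModType R) (p q : V) (s t : R) :
  segment_point p q t - segment_point p q s = (t - s) *: (q - p).
Proof. by rewrite /segment_point opprD addrACA subrr add0r -scalerBl. Qed.

Lemma segment_point_ball (R : realType) (V : normedModType R) (c p q : V) (r t : R) :
  0 <= t -> t <= 1 -> `|p - c| < r -> `|q - c| < r ->
  `|segment_point p q t - c| < r.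
Proof.
move=> t0 t1 pr qr.
have -> : segment_point p q t - c = (1 - t) *: (p - c) + t *: (q - c).
  rewrite scalerBl scale1r -[RHS]addrA [- (_ *: _) + _]addrC -scalerBr opprB.
  by rewrite [_ + (c - p)]addrA subrK /segment_point addrAC.
apply: le_lt_trans (ler_normD _ _) _; rewrite !normrZ !ger0_norm ?subr_ge0 //.
by case: (leP `|p - c| `|q - c|) => ?; nra.
Qed.

Lemma segment_point_segment (R : realType) (V : normedModType R) (p q : V) (a b t : R) :
  segment_point (segment_point p q a) (segment_point p q b) t =
  segment_point p q (a + t * (b - a)).
Proof.
rewrite {1}/segment_point segment_pointB scalerA /segment_point.
by rewrite [in RHS]scalerDl addrA.
Qed.

Lemma exists_small_factor (R : realType) (K e : R) : 0 <= K -> 0 < e ->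
  exists h, [/\ 0 < h, h <= 1 & K * h <= e].
Proof.
move=> K0 e0; have K1 : 0 < K + 1 by lra.
(* Dividing by [K + 1] covers the case [K = 0]. *)
exists (Num.min 1 (e / (K + 1))); split.
- by rewrite lt_min ltr01 divr_gt0.
- by rewrite ge_min lexx.
apply: (@le_trans _ _ (K * (e / (K + 1)))).
  by rewrite ler_wpM2l // ge_min lexx orbT.
by rewrite mulrA ler_pdivrMr //; nra.
Qed.

Lemma continuous_form_path (R : realType) (V : normedModType R) (U : set V)
    (w : V -> V -> R) (a b : R) (gamma v : R -> V) :
  continuous_form_on U w -> (forall t, a <= t -> t <= b -> U (gamma t)) ->
  {within `[a, b], continuous gamma} -> {within `[a, b], continuous v} ->
  {within `[a, b], continuous (fun t : R => w (gamma t) (v t))}.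
Proof.
move=> wU Ug /within_continuous_itvP gc /within_continuous_itvP vc.
apply/within_continuous_itvP => s as_ sb e e0.
have [_ wM wc] := wU; have [M HM] := wM _ (Ug s as_ sb).
have vs1 : 0 <= `|v s| + 1 by rewrite addr_ge0.
have e4 : 0 < e / 4 by lra.
have [e1 [e10 _ He1]] := exists_small_factor vs1 e4.
have [h [h0 h1 Hh]] := exists_small_factor (normr_ge0 M) e4.
have [d d0 Hd] := wc _ (Ug s as_ sb) e1 e10.
have [d1 d10 H1] := gc s as_ sb d d0; have [d2 d20 H2] := vc s as_ sb h h0.
exists (Num.min d1 d2); first by rewrite lt_min d10.
move=> y ay yb; rewrite lt_min => /andP[/(H1 y ay yb)/Hd {}H1 /(H2 y ay yb) {}H2].
(* First the base point changes at the fixed vector [v y], then the vector at the fixed base point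
   [gamma s]. *)
rewrite -(subrK (w (gamma s) (v y)) (w (gamma y) (v y))) -addrA.
rewrite -(continuous_formB _ _ _ wU).
apply: le_lt_trans (ler_normD _ _) _.
have vy : `|v y| <= `|v s| + 1.
  rewrite -(subrK (v s) (v y)) addrC; apply: le_trans (ler_normD _ _) _.
  by rewrite lerD2l; lra.
have A1 : e1 * `|v y| <= e / 4.
  by apply: le_trans He1; rewrite mulrC ler_wpM2r // ltW.
have A2 : M * `|v y - v s| <= e / 4.
  apply: le_trans Hh; apply: le_trans (ler_norm _) _.
  by rewrite normrM normr_id ler_wpM2l // ltW.
by have := H1 (v y); have := HM (v y - v s); lra.
Qed.

Lemma continuous_form_segment (R : realType) (V : normedModType R) (U : set V)
    (w : V -> V -> R) (p q : V) :
  continuous_form_on U w ->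
  (forall t, 0 <= t -> t <= 1 -> U (segment_point p q t)) ->
  {within `[0, 1], continuous (fun t : R => w (segment_point p q t) (q - p))}.
Proof.
move=> wU Upq; apply: (continuous_form_path wU Upq); last first.
  by apply: continuous_subspaceT => t; exact: cvg_cst.
apply/within_continuous_itvP => s s0 s1 e e0.
have n0 := normr_ge0 (q - p); have n1 : 0 < `|q - p| + 1 by lra.
exists (e / (`|q - p| + 1)); first by rewrite divr_gt0.
move=> y y0 y1; rewrite ltr_pdivlMr // => ys.
rewrite segment_pointB normrZ; apply: le_lt_trans ys.
by rewrite ler_wpM2l //; lra.
Qed.

(** Substitution [t := a + t (b - a)]. The order of [a] and [b] is free, so that additivity at the
    midpoint and the sign change under reversal both follow from one antiderivative [G]. *)
Lemma segment_integral_sub (R : realType) (V : normedModType R) (U : set V)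
    (w : V -> V -> R) (p q : V) (G : R -> R) (a b : R) :
  continuous_form_on U w ->
  (forall t, 0 <= t -> t <= 1 -> U (segment_point p q t)) ->
  has_derivative_on 0 1 G (fun t => w (segment_point p q t) (q - p)) ->
  0 <= a <= 1 -> 0 <= b <= 1 ->
  segment_integral w (segment_point p q a) (segment_point p q b) = G b - G a.
Proof.
move=> wU Upq dG /andP[a0 a1] /andP[b0 b1].
have st t : 0 <= t -> t <= 1 -> 0 <= a + t * (b - a) <= 1 by move=> *; nra.
rewrite /segment_integral.
rewrite (@Rintegral_derivative R (fun t => G (a + t * (b - a)))) //.
- by rewrite mul1r mul0r addr0 [a + _]addrC subrK.
- apply: continuous_compact_integrable; first exact: segment_compact.
  apply: continuous_form_segment wU _ => t t0 t1.
  by rewrite segment_point_segment; have /andP[? ?] := st t t0 t1; exact: Upq.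
move=> s s0 s1 e e0; have /andP[s'0 s'1] := st s s0 s1.
have [d d0 H] := dG _ s'0 s'1 e e0; exists d => // y y0 y1 ys.
have /andP[y'0 y'1] := st y y0 y1.
have yE : a + y * (b - a) - (a + s * (b - a)) = (y - s) * (b - a) by ring.
(* The substitution does not increase distances, so the radius [d] of [G] can be kept. *)
have ba1 : `|b - a| <= 1 by rewrite ler_norml; lra.
have n0 := normr_ge0 (y - s).
have le1 : `|(y - s) * (b - a)| <= `|y - s|.
  by rewrite normrM ler_piMr.
have := H _ y'0 y'1; rewrite yE => /(_ (le_lt_trans le1 ys)).
have -> : w (segment_point (segment_point p q a) (segment_point p q b) s)
     (segment_point p q b - segment_point p q a) =
   (b - a) * w (segment_point p q (a + s * (b - a))) (q - p).
  by rewrite segment_point_segment segment_pointB (continuous_formZ _ _ _ wU).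
have -> : (b - a) * w (segment_point p q (a + s * (b - a))) (q - p) * (y - s) =
  w (segment_point p q (a + s * (b - a))) (q - p) * ((y - s) * (b - a)) by ring.
by move=> {}H; apply: le_trans H _; rewrite ler_wpM2l // ltW.
Qed.

Lemma segment_antiderivative (R : realType) (V : normedModType R) (U : set V)
    (w : V -> V -> R) (p q : V) :
  continuous_form_on U w ->
  (forall t, 0 <= t -> t <= 1 -> U (segment_point p q t)) ->
  exists G, has_derivative_on 0 1 G (fun t => w (segment_point p q t) (q - p)).
Proof.
move=> wU Upq; eexists; apply: has_derivative_on_Rintegral.
exact: continuous_form_segment wU Upq.
Qed.

Lemma segment_integral_midpoint (R : realType) (V : normedModType R) (U : set V)
    (w : V -> V -> R) (p q : V) (m := segment_point p q 2^-1) :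
  continuous_form_on U w ->
  (forall t, 0 <= t -> t <= 1 -> U (segment_point p q t)) ->
  segment_integral w p q = segment_integral w p m + segment_integral w m q.
Proof.
move=> wU Upq; have [G dG] := segment_antiderivative wU Upq.
have J := segment_integral_sub wU Upq dG.
have h01 : 0 <= (2^-1 : R) <= 1 by lra.
have := J 0 1; have := J 0 2^-1; have := J 2^-1 1.
rewrite segment_point0 segment_point1 -/m !lexx ler01 h01.
by move=> -> // -> // -> //; ring.
Qed.

Lemma segment_integral_sym (R : realType) (V : normedModType R) (U : set V)
    (w : V -> V -> R) (p q : V) :
  continuous_form_on U w ->
  (forall t, 0 <= t -> t <= 1 -> U (segment_point p q t)) ->
  segment_integral w q p = - segment_integral w p q.
Proof.
move=> wU Upq; have [G dG] := segment_antiderivative wU Upq.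
have J := segment_integral_sub wU Upq dG.
have := J 0 1; have := J 1 0.
rewrite segment_point0 segment_point1 !lexx ler01.
by move=> -> // -> //; ring.
Qed.

(** With [K] an antiderivative of the integrand along the segment, [K t - G (segment_point p q t)]
    is locally Lipschitz with a constant arbitrarily close to [C |q - p|]. *)
Lemma segment_integral_approx (R : realType) (V : normedModType R) (U : set V)
    (w : V -> V -> R) (p q : V) (G : V -> R) (C : R) :
  continuous_form_on U w ->
  (forall t, 0 <= t -> t <= 1 -> U (segment_point p q t)) ->
  (forall t, 0 <= t -> t <= 1 -> forall h, 0 < h -> exists2 d, 0 < d &
     forall v, `|v| < d -> `|G (segment_point p q t + v) - G (segment_point p q t)
       - w (segment_point p q t) v| <= (C + h) * `|v|) ->
  `|segment_integral w p q - (G q - G p)| <= C * `|q - p|.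
Proof.
move=> wU Upq HG; have [K dK] := segment_antiderivative wU Upq.
have := segment_integral_sub wU Upq dK (a := 0) (b := 1).
rewrite segment_point0 segment_point1 !lexx ler01 => -> //.
have n0 := normr_ge0 (q - p); have n1 : 0 < `|q - p| + 1 by lra.
apply/ler_addgt0Pr => e e0.
(* An error [h] comes from [K] and an error [h |q - p|] from [G]; they add up to [e]. *)
pose h := e / (`|q - p| + 1); have h0 : 0 < h by rewrite divr_gt0.
have he : h * (`|q - p| + 1) = e by rewrite divfK // gt_eqF.
pose D t := K t - G (segment_point p q t).
have -> : K 1 - K 0 - (G q - G p) = D 1 - D 0.
  by rewrite /D segment_point0 segment_point1; ring.
have -> : C * `|q - p| + e = (h + (C + h) * `|q - p|) * (1 - 0) by rewrite -he; ring.
apply: locally_lipschitz_le => // s s0 s1.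
have [d d0 Hd] := dK s s0 s1 h h0.
have [d' d'0 Hd'] := HG s s0 s1 h h0.
exists (Num.min d (d' / (`|q - p| + 1))); first by rewrite lt_min d0 divr_gt0.
move=> y y0 y1; rewrite lt_min ltr_pdivlMr // => /andP[/(Hd y y0 y1) H1 ys].
have nE : `|(y - s) *: (q - p)| = `|y - s| * `|q - p| by rewrite normrZ.
have : `|(y - s) *: (q - p)| < d'.
  by rewrite nE; apply: le_lt_trans ys; rewrite ler_wpM2l //; lra.
move=> /Hd'; rewrite nE -[segment_point p q s + _](_ : segment_point p q y = _);
  last by rewrite -segment_pointB addrC subrK.
have -> : w (segment_point p q s) ((y - s) *: (q - p)) =
          w (segment_point p q s) (q - p) * (y - s).
  by rewrite (continuous_formZ _ _ _ wU) mulrC.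
move=> H2; rewrite /D.
set W := w _ _ * _ in H1 H2.
rewrite (_ : _ - _ - _ = (K y - K s - W) -
  (G (segment_point p q y) - G (segment_point p q s) - W)); last by ring.
by apply: (le_trans (ler_normB _ _)); rewrite mulrDl; apply: lerD => //;
  rewrite mulrAC -mulrA.
Qed.

(** * Goursat's lemma *)

Lemma exists_half_pow_lt (R : realType) (D d : R) : 0 < d ->
  exists n : nat, D / 2 ^+ n < d.
Proof.
move=> d0; have [D0|D0] := leP D 0.
  by exists 0%N; rewrite expr0 divr1; lra.
exists (Num.truncn (D / d)).+1; rewrite ltr_pdivrMr ?exprn_gt0 //.
rewrite mulrC -ltr_pdivrMr //; apply: lt_trans (truncnS_gt _) _.
by rewrite -natrX ltr_nat ltn_expl.
Qed.

Lemma geometric_step_limit (R : realType) (V : completeNormedModType R)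
    (x : nat -> V) (D : R) :
  (forall n, `|x n.+1 - x n| <= D / 2 ^+ n.+1) ->
  exists l, forall n, `|x n - l| <= D / 2 ^+ n.
Proof.
move=> Hx.
have D0 : 0 <= D.
  have := le_trans (normr_ge0 _) (Hx 0%N).
  by rewrite pmulr_lge0 // invr_gt0 exprn_gt0.
(* The partial sum of the geometric series is kept exactly, so that the induction on [m] closes. *)
have Hnm n m : `|x (n + m)%N - x n| <= D / 2 ^+ n - D / 2 ^+ (n + m).
  elim: m => [|m IH]; first by rewrite addn0 !subrr normr0.
  rewrite addnS -(subrK (x (n + m)%N) (x _)) -addrA.
  apply: le_trans (ler_normD _ _) _.
  have := Hx (n + m)%N; rewrite exprS invfM.
  by lra.
have Hn n m : (n <= m)%N -> `|x m - x n| <= D / 2 ^+ n.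
  move=> /subnKC <-; apply: le_trans (Hnm _ _) _.
  by rewrite lerBlDr lerDl divr_ge0 // exprn_ge0.
have /cauchy_cvgP/cvg_ex[l /cvgrPdist_lt xl] : cauchy (x @ \oo).
  apply/cauchy_exP => e e0; have [n Dn] := exists_half_pow_lt D e0.
  exists (x n); rewrite /fmapE; exists n => // m /= nm.
  by rewrite -ball_normE /= distrC; apply: le_lt_trans Dn; exact: Hn.
exists l => n; apply/ler_addgt0Pr => e e0.
have [N _ HN] := xl e e0.
have := HN (maxn n N) (leq_maxr _ _); have := Hn n (maxn n N) (leq_maxl _ _).
move=> H1 H2; rewrite distrC -(subrK (x (maxn n N)) l) -addrA.
by apply: le_trans (ler_normD _ _) _; lra.
Qed.

Lemma segment_point_mid (R : realType) (V : normedModType R) (p q : V) :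
  segment_point p q 2^-1 = 2^-1 *: (p + q).
Proof.
rewrite /segment_point scalerBr scalerDr addrCA addrC; congr (_ + _).
by rewrite -[X in X - _](scale1r p) -scalerBl; congr (_ *: _); lra.
Qed.

Lemma norm_mid_sub (R : realType) (V : normedModType R) (a b c : V) :
  `|2^-1 *: (a + b) - 2^-1 *: (a + c)| = `|b - c| / 2.
Proof.
rewrite -scalerBr opprD addrACA subrr add0r normrZ ger0_norm ?invr_ge0 //.
by rewrite mulrC.
Qed.

Definition triangle_integral (R : realType) (V : normedModType R)
    (w : V -> V -> R) (x : V * V * V) : R :=
  segment_integral w x.1.1 x.1.2 + segment_integral w x.1.2 x.2
  + segment_integral w x.2 x.1.1.

(** The ball is convex and keeps all subtriangles in the domain; [d] bounds the sides and halves at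
    each bisection. *)
Definition in_ball_diam (R : realType) (V : normedModType R) (c : V) (r d : R)
    (x : V * V * V) : Prop :=
  [/\ `|x.1.1 - c| < r, `|x.1.2 - c| < r & `|x.2 - c| < r] /\
  [/\ `|x.1.1 - x.1.2| <= d, `|x.1.2 - x.2| <= d & `|x.2 - x.1.1| <= d].

(** One of the four triangles cut out by the midpoints carries at least a quarter of the integral,
    while [d ^+ 2] is also divided by four. The control of the first vertex makes the iterated
    triangles converge. *)
Lemma triangle_bisection (R : realType) (V : normedModType R) (U : set V)
    (w : V -> V -> R) (c : V) (r d e : R) (x : V * V * V) :
  continuous_form_on U w -> (forall u, `|u - c| < r -> U u) ->
  in_ball_diam c r d x -> e * d ^+ 2 < `|triangle_integral w x| ->
  exists y, [/\ in_ball_diam c r (d / 2) y,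
    e * (d / 2) ^+ 2 < `|triangle_integral w y| & `|y.1.1 - x.1.1| <= d / 2].
Proof.
case: x => [[p q] s] wU Uc [/= [pc qc sc] [pq qs sp]].
pose m (a b : V) := 2^-1 *: (a + b).
have mC a b : m a b = m b a by rewrite /m addrC.
have mm a : m a a = a.
  by rewrite /m -mulr2n -[a *+ 2]scaler_nat scalerA mulVf ?scale1r.
have mE a b : segment_point a b 2^-1 = m a b by exact: segment_point_mid.
have mB a b b' : `|m a b - m a b'| = `|b - b'| / 2 by exact: norm_mid_sub.
have seg a b : `|a - c| < r -> `|b - c| < r ->
    forall t, 0 <= t -> t <= 1 -> U (segment_point a b t).
  by move=> ac bc t t0 t1; apply: Uc; exact: segment_point_ball.
have mc a b : `|a - c| < r -> `|b - c| < r -> `|m a b - c| < r.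
  by move=> ac bc; rewrite -mE; apply: segment_point_ball => //; lra.
have J2 a b : `|a - c| < r -> `|b - c| < r ->
    segment_integral w a b = segment_integral w a (m a b) + segment_integral w (m a b) b.
  by move=> ac bc; rewrite -mE; apply: segment_integral_midpoint wU _; exact: seg.
have JC a b : `|a - c| < r -> `|b - c| < r ->
    segment_integral w b a = - segment_integral w a b.
  by move=> ac bc; apply: segment_integral_sym wU _; exact: seg.
have mpq := mc _ _ pc qc; have mqs := mc _ _ qc sc; have msp := mc _ _ sc pc.
(* Three corner triangles and the middle one, oriented so that each inner side is run through once
   in each direction. *)
have E : triangle_integral w (p, q, s) =
    triangle_integral w (p, m p q, m s p) + triangle_integral w (m p q, q, m q s)
    + triangle_integral w (m s p, m q s, s) + triangle_integral w (m p q, m q s, m s p).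
  rewrite /triangle_integral /= (J2 p q) // (J2 q s) // (J2 s p) //.
  rewrite (JC (m p q) (m s p)) // (JC (m p q) (m q s)) // (JC (m q s) (m s p)) //.
  by ring.
(* A corner triangle is the image of the whole one under the homothety of ratio [1/2] centred at its
   vertex. *)
have sub a : `|a - c| < r -> in_ball_diam c r (d / 2) (m a p, m a q, m a s).
  by move=> ac; split; split; rewrite /= ?mB ?mc //; lra.
have subp : in_ball_diam c r (d / 2) (p, m p q, m s p).
  by have := sub _ pc; rewrite mm (mC p s).
have subq : in_ball_diam c r (d / 2) (m p q, q, m q s).
  by have := sub _ qc; rewrite mm (mC q p).
have subs : in_ball_diam c r (d / 2) (m s p, m q s, s).
  by have := sub _ sc; rewrite mm (mC s q).
have subm : in_ball_diam c r (d / 2) (m p q, m q s, m s p).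
  split; first by split.
  split => /=.
  - by rewrite (mC p q) mB distrC; lra.
  - by rewrite (mC q s) mB distrC; lra.
  - by rewrite (mC s p) mB distrC; lra.
have pmq : `|m p q - p| <= d / 2 by rewrite -{2}(mm p) mB distrC; lra.
have pms : `|m s p - p| <= d / 2 by rewrite mC -{2}(mm p) mB; lra.
have d0 : 0 <= d by exact: le_trans (normr_ge0 _) pq.
rewrite E => big.
have [H|H1] := ltP (e * (d / 2) ^+ 2) `|triangle_integral w (p, m p q, m s p)|.
  by exists (p, m p q, m s p); split => //; rewrite subrr normr0; lra.
have [H|H2] := ltP (e * (d / 2) ^+ 2) `|triangle_integral w (m p q, q, m q s)|.
  by exists (m p q, q, m q s).
have [H|H3] := ltP (e * (d / 2) ^+ 2) `|triangle_integral w (m s p, m q s, s)|.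
  by exists (m s p, m q s, s).
exists (m p q, m q s, m s p); split => //.
rewrite ltNge; apply/negP => H4; move: big; apply/negP; rewrite -leNgt.
move: H1 H2 H3 H4; rewrite !ler_norml.
have -> : e * d ^+ 2 = e * (d / 2) ^+ 2 + e * (d / 2) ^+ 2 + e * (d / 2) ^+ 2
  + e * (d / 2) ^+ 2 by field.
by lra.
Qed.

(** Goursat's argument by contradiction: bisection keeps the integral above [e dn ^+ 2] on triangles
    of side at most [dn] shrinking to [l], while closedness at [l] bounds it by [e dn ^+ 2]. *)
Lemma triangle_integral_eq0 (R : realType) (V : completeNormedModType R)
    (U : set V) (w : V -> V -> R) (c p q s : V) (r : R) :
  continuous_form_on U w -> closed_form_on U w ->
  (forall u, `|u - c| <= r -> U u) ->
  `|p - c| < r -> `|q - c| < r -> `|s - c| < r ->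
  segment_integral w p q + segment_integral w q s + segment_integral w s p = 0.
Proof.
move=> wU wcl Uc pc qc sc.
apply/eqP; apply: contraT => neq0; exfalso.
have {}neq0 : 0 < `|triangle_integral w (p, q, s)| by rewrite normr_gt0.
pose D := `|p - q| + `|q - s| + `|s - p| + 1.
have := normr_ge0 (p - q); have := normr_ge0 (q - s); have := normr_ge0 (s - p).
move=> n1 n2 n3; have D0 : 0 < D by rewrite /D; lra.
(* The factor 2 makes the initial inequality of [P] strict. *)
pose e := `|triangle_integral w (p, q, s)| / (2 * D ^+ 2).
have D2 : 0 < 2 * D ^+ 2 by rewrite mulr_gt0 // exprn_gt0.
have e0 : 0 < e by rewrite divr_gt0.
pose P d x := in_ball_diam c r d x /\ e * d ^+ 2 < `|triangle_integral w x|.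
have P0 : P D (p, q, s).
  split; first by split; split => //=; rewrite /D; lra.
  have : e * (2 * D ^+ 2) = `|triangle_integral w (p, q, s)|.
    by rewrite divfK // gt_eqF.
  by move=> <-; rewrite ltr_pM2l // ltr_pMl ?exprn_gt0 // ltr1n.
(* The implication is put under the existential so that choice yields a total function; where [P]
   fails the triangle is returned unchanged. *)
have step (dx : R * (V * V * V)) : exists y, P dx.1 dx.2 ->
    P (dx.1 / 2) y /\ `|y.1.1 - dx.2.1.1| <= dx.1 / 2.
  have [[H1 H2]|nP] := pselect (P dx.1 dx.2); last by exists dx.2.
  have Uc' u : `|u - c| < r -> U u by move=> /ltW; exact: Uc.
  by have [y [? ? ?]] := triangle_bisection wU Uc' H1 H2; exists y.
have [next Hnext] := choice step.
pose z n := iter n (fun dx : R * (V * V * V) => (dx.1 / 2, next dx)) (D, (p, q, s)).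
have z1 n : (z n).1 = D / 2 ^+ n.
  elim: n => [|n IH]; first by rewrite /= expr0 divr1.
  by rewrite /z iterS -/(z n) /= IH exprSr invfM mulrA.
have zP n : P (D / 2 ^+ n) (z n).2.
  elim: n => [|n IH]; first by rewrite /= expr0 divr1.
  rewrite -z1 /z iterS -/(z n) /=; rewrite -z1 in IH.
  by have [] := Hnext _ IH.
have [l Hl] : exists l, forall n, `|(z n).2.1.1 - l| <= D / 2 ^+ n.
  apply: geometric_step_limit => n; rewrite -z1.
  rewrite {1 3}/z iterS -/(z n) /=.
  by have := zP n; rewrite -z1 => /Hnext[].
(* The limit may reach the boundary of the ball, so the hypothesis on the closed ball is used. *)
have Ul : U l.
  apply: Uc; apply/ler_addgt0Pr => h h0.
  have [n Hn] := exists_half_pow_lt D h0.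
  have [[[zc _ _] _] _] := zP n.
  rewrite -(subrK (z n).2.1.1 l) -addrA; apply: le_trans (ler_normD _ _) _.
  by have := Hl n; rewrite distrC; lra.
(* Three sides, each of length at most [dn] and within [3 dn] of [l], contribute
   [3 (e / 9) (3 dn) dn = e dn ^+ 2]; the increments of [G] cancel around the triangle. *)
have e9 : 0 < e / 9 by lra.
have [d d0 [G HG]] := wcl l Ul _ e9.
have d3 : 0 < d / 3 by lra.
have [n Hn] := exists_half_pow_lt D d3.
have [[[]]] := zP n; have := Hl n.
case: (z n).2 => [[a b] f] /=; set dn := D / 2 ^+ n in Hn *.
have dn0 : 0 < dn by rewrite divr_gt0 // exprn_gt0.
move=> al ac bc fc [ab bf fa].
apply/negP; rewrite -leNgt.
have near v : `|v - a| <= dn -> `|v - l| < 3 * dn.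
  move=> va; rewrite -(subrK a v) -addrA; apply: le_lt_trans (ler_normD _ _) _.
  by lra.
have la : `|a - l| < 3 * dn by apply: near; rewrite subrr normr0 ltW.
have lb : `|b - l| < 3 * dn by apply: near; rewrite distrC.
have lf : `|f - l| < 3 * dn by exact: near.
have est u v : `|u - c| < r -> `|v - c| < r -> `|u - l| < 3 * dn ->
    `|v - l| < 3 * dn -> `|u - v| <= dn ->
    `|segment_integral w u v - (G v - G u)| <= e / 9 * (3 * dn) * dn.
  move=> uc vc ul vl uv.
  apply: (@le_trans _ _ (e / 9 * (3 * dn) * `|v - u|)); last first.
    by rewrite distrC ler_wpM2l // mulr_ge0 ?ltW //; lra.
  apply: (segment_integral_approx wU).
    by move=> t t0 t1; apply: Uc; apply: ltW; exact: segment_point_ball.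
  move=> t t0 t1 h h0.
  have tl : `|segment_point u v t - l| < 3 * dn by exact: segment_point_ball.
  have [|d' d'0 H'] := HG (segment_point u v t) _ h h0; first by lra.
  exists d' => // v' /H'/le_trans; apply; rewrite ler_wpM2r // lerD2r.
  by rewrite ler_wpM2l // ltW.
have := est _ _ ac bc la lb ab.
have := est _ _ bc fc lb lf bf.
have := est _ _ fc ac lf la fa.
have -> : e * dn ^+ 2 = e / 9 * (3 * dn) * dn + e / 9 * (3 * dn) * dn +
  e / 9 * (3 * dn) * dn by field.
by rewrite /triangle_integral /= !ler_norml; lra.
Qed.

(** * Homotopies *)

Definition has_velocity_on (R : realType) (V : normedModType R) (a b : R)
    (gamma v : R -> V) : Prop :=
  forall s, a <= s -> s <= b -> forall e, 0 < e -> exists2 d, 0 < d &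
    forall y, a <= y -> y <= b -> `|y - s| < d ->
      `|gamma y - gamma s - (y - s) *: v s| <= e * `|y - s|.

(** Two approximations: on a short chord [w] is nearly its value at [gamma s], and the chord is
    nearly [(y - s) *: v s]. *)
Lemma has_velocity_on_segment (R : realType) (V : normedModType R) (U : set V)
    (w : V -> V -> R) (a b : R) (gamma v : R -> V) :
  continuous_form_on U w -> has_velocity_on a b gamma v ->
  (forall s y, a <= s -> s <= b -> a <= y -> y <= b ->
    forall t, 0 <= t -> t <= 1 -> U (segment_point (gamma s) (gamma y) t)) ->
  forall s, a <= s -> s <= b -> forall e, 0 < e -> exists2 d, 0 < d &
    forall y, a <= y -> y <= b -> `|y - s| < d ->
      `|segment_integral w (gamma s) (gamma y) - w (gamma s) (v s) * (y - s)|
        <= e * `|y - s|.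
Proof.
move=> wU dgamma Useg s as_ sb e e0.
have Us : U (gamma s).
  by have := Useg s s as_ sb as_ sb 0 (lexx _) ler01; rewrite segment_point0.
have [_ wM wc] := wU.
have [M HM] := wM _ Us.
have L0 := normr_ge0 (v s); have L1 : 0 < `|v s| + 1 by lra.
have M0 := normr_ge0 M; have M1 : 0 < `|M| + 1 by lra.
pose e1 := Num.min 1 (e / 2 / (`|M| + 1)).
have e10 : 0 < e1 by rewrite lt_min ltr01 !divr_gt0.
have e11 : e1 <= 1 by rewrite ge_min lexx.
have e1M : `|M| * e1 <= e / 2.
  have : e1 <= e / 2 / (`|M| + 1) by rewrite ge_min lexx orbT.
  by rewrite ler_pdivlMr //; nra.
pose e2 := e / 2 / (`|v s| + 1).
have e20 : 0 < e2 by rewrite !divr_gt0.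
have e2E : e2 * (`|v s| + 1) = e / 2 by rewrite divfK // gt_eqF.
have [d1 d10 H1] := dgamma s as_ sb e1 e10.
have [d2 d20 H2] := wc _ Us e2 e20.
exists (Num.min d1 (d2 / (`|v s| + 1))); first by rewrite lt_min d10 divr_gt0.
move=> y ay yb; rewrite lt_min ltr_pdivlMr // => /andP[/(H1 y ay yb) {}H1 ys].
set p := gamma s in Us HM H1 H2 *; set q := gamma y in H1 *.
have y0 := normr_ge0 (y - s).
have qp : `|q - p| <= (`|v s| + 1) * `|y - s|.
  rewrite -(subrK ((y - s) *: v s) (q - p)); apply: le_trans (ler_normD _ _) _.
  by rewrite normrZ; nra.
have wB x x' : w p x - w p x' = w p (x - x') by rewrite (continuous_formB _ _ _ wU).
have A1 : `|segment_integral w p q - w p (q - p)| <= e2 * `|q - p|.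
  (* The linear function [w p] itself serves as the approximate primitive [G]. *)
  rewrite -wB; apply: (segment_integral_approx wU (Useg _ _ as_ sb ay yb)).
  move=> t t0 t1 h h0; exists 1 => // x _.
  rewrite wB [_ + x]addrC addrK distrC; apply: le_trans (H2 _ _ x) _.
    rewrite -[X in _ - X](segment_point0 p q) segment_pointB subr0 normrZ.
    rewrite (ger0_norm t0); apply: le_lt_trans ys.
    by have := normr_ge0 (q - p); rewrite [`|y - s| * _]mulrC; nra.
  by rewrite ler_wpM2r //; lra.
have A2 : `|w p (q - p) - w p (v s) * (y - s)| <= `|M| * (e1 * `|y - s|).
  have -> : w p (v s) * (y - s) = w p ((y - s) *: v s).
    by rewrite (continuous_formZ _ _ _ wU) mulrC.
  rewrite wB; apply: le_trans (HM _) _; apply: le_trans (ler_norm _) _.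
  by rewrite normrM normr_id ler_wpM2l.
rewrite -(subrK (w p (q - p)) (segment_integral _ _ _)) -addrA.
apply: le_trans (ler_normD _ _) _.
have A3 : e2 * `|q - p| <= e / 2 * `|y - s|.
  by rewrite -e2E -mulrA ler_wpM2l // ltW.
have : `|M| * (e1 * `|y - s|) <= e / 2 * `|y - s| by rewrite mulrA ler_wpM2r.
by lra.
Qed.

(** The vanishing integral around [gamma a], [gamma s], [gamma y] turns the increment of the
    integral over chords from [gamma a] into the integral over the chord from [gamma s] to
    [gamma y], whose derivative at [s] is known. *)
Lemma Rintegral_path_in_ball (R : realType) (V : completeNormedModType R)
    (U : set V) (w : V -> V -> R) (c : V) (r a b : R) (gamma v : R -> V) :
  continuous_form_on U w -> closed_form_on U w ->
  (forall u, `|u - c| <= r -> U u) ->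
  a <= b -> has_velocity_on a b gamma v ->
  (forall s, a <= s -> s <= b -> `|gamma s - c| < r) ->
  (@lebesgue_measure R).-integrable `[a, b] (fun s => (w (gamma s) (v s))%:E) ->
  \int[@lebesgue_measure R]_(s in `[a, b]) w (gamma s) (v s) =
    segment_integral w (gamma a) (gamma b).
Proof.
move=> wU wcl Uc ab dgamma gc ig.
have tri p q s : `|p - c| < r -> `|q - c| < r -> `|s - c| < r ->
    segment_integral w p q + segment_integral w q s + segment_integral w s p = 0.
  exact: triangle_integral_eq0 wU wcl Uc.
have Useg s y : a <= s -> s <= b -> a <= y -> y <= b ->
    forall t, 0 <= t -> t <= 1 -> U (segment_point (gamma s) (gamma y) t).
  move=> as_ sb ay yb t t0 t1; apply: Uc; apply: ltW.
  by apply: segment_point_ball => //; exact: gc.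
rewrite (@Rintegral_derivative R (fun y => segment_integral w (gamma a) (gamma y))) //.
  have ga := gc a (lexx _) ab.
  (* The degenerate triangle at [gamma a] shows that the primitive starts at 0. *)
  by have := tri _ _ _ ga ga ga; lra.
move=> s as_ sb e e0.
have [d d0 H] := has_velocity_on_segment wU dgamma Useg as_ sb e0.
exists d => // y ay yb ys; have := H y ay yb ys.
have := tri _ _ _ (gc a (lexx _) ab) (gc s as_ sb) (gc y ay yb).
rewrite (segment_integral_sym wU (Useg _ _ (lexx _) ab ay yb)) => T.
by rewrite (_ : segment_integral w (gamma s) (gamma y) =
  segment_integral w (gamma a) (gamma y) - segment_integral w (gamma a) (gamma s)) //; lra.
Qed.

Lemma Rintegral_partition (R : realType) (s : nat -> R) (f : R -> R) (n : nat) :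
  (forall i, s i <= s i.+1) ->
  (@lebesgue_measure R).-integrable `[s 0%N, s n] (EFin \o f) ->
  \int[@lebesgue_measure R]_(x in `[s 0%N, s n]) f x =
    \sum_(i < n) \int[@lebesgue_measure R]_(x in `[s i, s i.+1]) f x.
Proof.
move=> si; have smono i j : (i <= j)%N -> s i <= s j.
  by move/nondecreasing_seqP : si => si; exact: si.
elim: n => [|n IH] ig; first by rewrite big_ord0 set_itv1 Rintegral_set1.
have s0n := smono 0%N n (leq0n _).
rewrite big_ord_recr /= -IH; last first.
  by apply: integrableS ig => //; apply: subset_itv; rewrite bnd_simp.
rewrite -[X in _ + X]Rintegral_itv_obnd_cbnd; last first.
  by apply: integrableS ig => //; apply: subset_itv; rewrite bnd_simp.
by rewrite -(Rintegral_itvB (a := BLeft (s 0%N)) ig) ?bnd_simp // addrC subrK.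
Qed.

(** A Lebesgue number for the square: compactness makes the mesh uniform, while each cell keeps its
    own ball inside [U]. *)
Lemma homotopy_grid (R : realType) (V : normedModType R) (U : set V)
    (H : R * R -> V) :
  open U -> {within `[0, 1] `*` `[0, 1], continuous H} ->
  H @` (`[0, 1] `*` `[0, 1]) `<=` U ->
  exists N : nat, forall x y : R, 0 <= x <= 1 -> 0 <= y <= 1 ->
    exists c r, (forall u, `|u - c| <= r -> U u) /\
      forall s t : R, 0 <= s <= 1 -> 0 <= t <= 1 ->
        `|s - x| <= N.+1%:R^-1 -> `|t - y| <= N.+1%:R^-1 -> `|H (s, t) - c| < r.
Proof.
move=> oU /subspace_continuousP Hc HU.
have cK : compact (`[0, 1]%classic `*` `[0, 1]%classic : set (R * R)).
  by apply: compact_setX; exact: segment_compact.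
pose P (N : nat) (x : R * R) := exists c r, (forall u, `|u - c| <= r -> U u) /\
      forall s t : R, 0 <= s <= 1 -> 0 <= t <= 1 ->
        `|s - x.1| <= N.+1%:R^-1 -> `|t - x.2| <= N.+1%:R^-1 -> `|H (s, t) - c| < r.
have := (compact_near_coveringP _).1 cK nat \oo P _.
case=> [x Kx|N _ HN].
  have Ux : U (H x) by apply: HU; exists x.
  have /nbhs_ballP[r /= r0 rU] : nbhs (H x) U by exact: open_nbhs_nbhs.
  have /cvgrPdist_lt/(_ (r / 2)) Hx := Hc x Kx.
  have r2 : 0 < r / 2 by lra.
  have /nbhs_ballP[d /= d0 dH] := Hx r2.
  have d2 : 0 < d / 2 by lra.
  (* Half of [d] is for moving the point [x], half for the mesh. *)
  exists (ball x (d / 2), [set n | n.+1%:R^-1 < d / 2]); first split => /=.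
  - exact: nbhsx_ballx.
  - exact: (near_infty_natSinv_lt (PosNum d2)).
  case=> x' n /= [[x1 x2] dn]; exists (H x), (r / 2); split.
    by move=> u ux; apply: rU; rewrite -ball_normE /= distrC; lra.
  move=> s t s01 t01 sx tx; rewrite distrC; apply: dH; last first.
    by split; rewrite /= in_itv.
  move: x1 x2; rewrite /ball /= => x1 x2; split; rewrite /ball /=.
  - apply: le_lt_trans (ler_distD x'.1 _ _) _; rewrite [d]splitr.
    by rewrite ltrD // distrC (le_lt_trans sx).
  - apply: le_lt_trans (ler_distD x'.2 _ _) _; rewrite [d]splitr.
    by rewrite ltrD // distrC (le_lt_trans tx).
exists N => x y x01 y01; apply: (HN N (leqnn _) (x, y)).
by split; rewrite /= in_itv.
Qed.

(** The sums [S j] over two adjacent rows differ by a telescoping sum of vertical chords [W j i],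
    which vanish on the two sides, where [H] is constant. The last row is constant. The balls of the
    first clause serve to compare the bottom row with the loop. *)
Lemma null_homotopy_grid_sum (R : realType) (V : completeNormedModType R)
    (U : set V) (w : V -> V -> R) (H : R * R -> V) (x0 : V) :
  continuous_form_on U w -> closed_form_on U w -> open U ->
  {within `[0, 1] `*` `[0, 1], continuous H} ->
  H @` (`[0, 1] `*` `[0, 1]) `<=` U ->
  (forall s, 0 <= s <= 1 -> H (s, 1) = x0) ->
  (forall t, 0 <= t <= 1 -> H (0, t) = x0 /\ H (1, t) = x0) ->
  exists N : nat,
    (forall i : nat, (i <= N)%N -> exists c r, (forall u, `|u - c| <= r -> U u) /\
      forall s, i%:R / N.+1%:R <= s <= i.+1%:R / N.+1%:R -> `|H (s, 0) - c| < r) /\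
    \sum_(i < N.+1) segment_integral w (H (i%:R / N.+1%:R, 0))
      (H (i.+1%:R / N.+1%:R, 0)) = 0.
Proof.
move=> wU wcl oU Hc HU Htop Hside.
have [N HN] := homotopy_grid oU Hc HU; exists N.
pose g (i : nat) : R := i%:R / N.+1%:R.
have g01 i : (i <= N.+1)%N -> 0 <= g i <= 1.
  by move=> iN; rewrite /g divr_ge0 //= ler_pdivrMr // mul1r ler_nat.
have gS i : g i.+1 = g i + N.+1%:R^-1 by rewrite /g -natr1 mulrDl mul1r.
have Ninv : 0 < N.+1%:R^-1 :> R by rewrite invr_gt0.
have g0 : g 0%N = 0 by rewrite /g mul0r.
have g1 : g N.+1 = 1 by rewrite /g divff.
have g_near i : `|g i - g i| <= N.+1%:R^-1 /\ `|g i.+1 - g i| <= N.+1%:R^-1.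
  by rewrite subrr normr0 gS addrAC subrr add0r gtr0_norm.
split=> [i iN|].
  have i01 : 0 <= g i <= 1 by apply: g01; exact: leqW.
  have z01 : 0 <= (0 : R) <= 1 by rewrite lexx ler01.
  have [c [r [cU cr]]] := HN (g i) 0 i01 z01; exists c, r; split => // s.
  rewrite -/(g i) -/(g i.+1) => /andP[is_ si].
  apply: cr => //.
  - have /andP[i0 _] := i01; have /andP[_ i1] := g01 i.+1 iN.
    by rewrite (le_trans i0 is_) (le_trans si i1).
  - by rewrite ger0_norm ?subr_ge0 // lerBlDl -gS.
  - by rewrite subrr normr0 ltW.
pose J := segment_integral w.
pose S (j : nat) := \sum_(i < N.+1) J (H (g i, g j)) (H (g i.+1, g j)).
pose W (j i : nat) := J (H (g i, g j)) (H (g i, g j.+1)).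
have tri00 p : U p -> J p p = 0.
  move=> Up; rewrite /J /segment_integral.
  under eq_Rintegral do rewrite subrr (continuous_form0 _ wU).
  by rewrite Rintegral_cst_itv // mul0r.
have Ux0 : U x0.
  have e01 : 0 <= (1 : R) <= 1 by rewrite lexx ler01.
  rewrite -(Htop 1 e01); apply: HU; exists (1, 1) => //.
(* The image of a cell is cut along its diagonal into two triangles, both in the ball of that
   cell. *)
have cell j i : (j <= N)%N -> (i <= N)%N ->
    J (H (g i, g j)) (H (g i.+1, g j)) - J (H (g i, g j.+1)) (H (g i.+1, g j.+1)) =
    - (W j i.+1 - W j i).
  move=> jN iN.
  have [c [r [cU cr]]] := HN _ _ (g01 i (leqW iN)) (g01 j (leqW jN)).
  have [ni0 ni1] := g_near i; have [nj0 nj1] := g_near j.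
  have i0 := g01 i (leqW iN); have i1 := g01 i.+1 iN.
  have j0 := g01 j (leqW jN); have j1 := g01 j.+1 jN.
  have h00 := cr _ _ i0 j0 ni0 nj0; have h10 := cr _ _ i1 j0 ni1 nj0.
  have h01 := cr _ _ i0 j1 ni0 nj1; have h11 := cr _ _ i1 j1 ni1 nj1.
  have sym p q : `|p - c| < r -> `|q - c| < r -> J q p = - J p q.
    move=> pc qc; apply: segment_integral_sym wU _ => t t0 t1.
    by apply: cU; apply: ltW; exact: segment_point_ball.
  have T1 := triangle_integral_eq0 wU wcl cU h00 h10 h11.
  have T2 := triangle_integral_eq0 wU wcl cU h00 h11 h01.
  have := sym _ _ h00 h11; have := sym _ _ h01 h11; have := sym _ _ h00 h01.
  by rewrite /W -/J in T1 T2 *; lra.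
have SS j : (j <= N)%N -> S j = S j.+1.
  move=> jN; apply/eqP; rewrite -subr_eq0 /S -sumrB.
  rewrite (eq_bigr (fun i : 'I_N.+1 => - (W j i.+1 - W j i))); last first.
    by move=> i _; apply: cell => //; rewrite -ltnS.
  rewrite sumrN -(big_mkord xpredT (fun i => W j i.+1 - W j i)) telescope_sumr //.
  have [j0a j0b] := Hside _ (g01 j (leqW jN)); have [j1a j1b] := Hside _ (g01 j.+1 jN).
  by rewrite /W g0 g1 j0a j0b j1a j1b !tri00 // subrr oppr0.
have S0 j : (j <= N.+1)%N -> S 0%N = S j.
  by elim: j => // j IH jN; rewrite -(SS j jN); apply: IH; exact: ltnW.

transitivity (S 0%N); first by rewrite /S g0.
rewrite (S0 _ (leqnn _)) /S g1 big1 // => i _.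
by rewrite !Htop ?tri00 // g01 // ltnW.
Qed.

(** The grid scaled by [T] subdivides [[0, T]]; each piece of the loop stays in a ball inside [U],
    so its integral equals that of its chord. *)
Lemma Rintegral_null_homotopic (R : realType) (V : completeNormedModType R)
    (U : set V) (w : V -> V -> R) (H : R * R -> V) (x0 : V) (T : R)
    (gamma v : R -> V) :
  continuous_form_on U w -> closed_form_on U w -> open U ->
  {within `[0, 1] `*` `[0, 1], continuous H} ->
  H @` (`[0, 1] `*` `[0, 1]) `<=` U ->
  (forall s, 0 <= s <= 1 -> H (s, 1) = x0) ->
  (forall t, 0 <= t <= 1 -> H (0, t) = x0 /\ H (1, t) = x0) ->
  0 < T -> (forall s, 0 <= s <= 1 -> H (s, 0) = gamma (T * s)) ->
  has_velocity_on 0 T gamma v ->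
  (@lebesgue_measure R).-integrable `[0, T] (fun s => (w (gamma s) (v s))%:E) ->
  \int[@lebesgue_measure R]_(s in `[0, T]) w (gamma s) (v s) = 0.
Proof.
move=> wU wcl oU Hc HU Htop Hside T0 Hg dgamma ig.
have [N [HN sum0]] := null_homotopy_grid_sum wU wcl oU Hc HU Htop Hside.
pose s (i : nat) : R := T * (i%:R / N.+1%:R).
have s0 : s 0%N = 0 by rewrite /s mul0r mulr0.
have s1 : s N.+1 = T by rewrite /s divff // mulr1.
have sS i : s i <= s i.+1.
  by rewrite /s ler_pM2l // ler_pM2r ?invr_gt0 // ler_nat.
have smono : {homo s : i j / (i <= j)%N >-> i <= j}.
  by move/nondecreasing_seqP : sS => sS i j; exact: sS.
have := @Rintegral_partition R s (fun x => w (gamma x) (v x)) N.+1 sS.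
rewrite s0 s1 => ->; last exact: ig.
rewrite -[RHS]sum0; apply: eq_bigr => i _.
have iN : (i <= N)%N by rewrite -ltnS.
have i0 : 0 <= s i by rewrite -s0; exact: smono.
have i1 : s i.+1 <= T by rewrite -s1; exact: smono.
have sub : `[s i, s i.+1] `<=` `[0, T] by apply: subset_itv; rewrite bnd_simp.
have frac01 (k : nat) : (k <= N.+1)%N -> 0 <= (k%:R / N.+1%:R : R) <= 1.
  by move=> kN; rewrite divr_ge0 //= ler_pdivrMr // mul1r ler_nat.
rewrite !Hg ?frac01 // ?(ltnW (ltn_ord i)) // -/(s _).
have [c [r [cU cr]]] := HN i iN.
apply: (Rintegral_path_in_ball wU wcl cU) => //.
- move=> x ix xi e e0; have [d d0 Hd] := dgamma x (le_trans i0 ix) (le_trans xi i1) e e0.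
  by exists d => // y iy yi; apply: Hd; [exact: le_trans iy|exact: le_trans i1].
- move=> x ix xi.
  have := cr (x / T); rewrite Hg; last first.
    rewrite ler_pdivrMr // mul1r (le_trans xi i1) andbT.
    by apply: divr_ge0; [exact: le_trans i0 ix|exact: ltW].
  rewrite [T * (x / T)]mulrC divfK ?gt_eqF //; apply.
  by rewrite ler_pdivlMr // ler_pdivrMr // -!(mulrC T) ix.
- by apply: integrableS ig.
Qed.

(** * The form of the line integral *)

Lemma norm_entry_le (R : realType) (k : nat) (v : 'rV[R]_k) (j : 'I_k) :
  `|v 0 j| <= `|v|.
Proof.
rewrite [leRHS]/Num.Def.normr /= mx_normrE.
exact: (le_bigmax _ (fun ij : 'I_1 * 'I_k => `|v ij.1 ij.2|) (0, j)).
Qed.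

Lemma linear_row_bound (R : realType) (k : nat) (V : normedModType R)
    (f : 'rV[R]_k -> V) : linear f ->
  forall v, `|f v| <= (\sum_(j < k) `|f 'e_j|) * `|v|.
Proof.
(* Linearity is a plain hypothesis here and is packed into a structure so that [f] can be expanded
   on the basis. *)
move=> lf v; pose F := GRing.isLinear.Build _ _ _ _ f lf.
pose g : {linear 'rV[R]_k -> V} := HB.pack f F.
rewrite -[f]/(g : _ -> _) [in leLHS](row_sum_delta v) linear_sum mulr_suml.
apply: le_trans (ler_norm_sum _ _ _) _; apply: ler_sum => j _.
by rewrite linearZ normrZ mulrC ler_wpM2l // norm_entry_le.
Qed.

Lemma amul_bound (R : realType) (n : nat) (A : algebra_on R n) :
  exists2 C, 0 <= C & forall a b, `|amul A a b| <= C * `|a| * `|b|.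
Proof.
exists (\sum_(j < n) \sum_(i < n) `|amul A 'e_i 'e_j|).
  by apply: sumr_ge0 => j _; apply: sumr_ge0.
move=> a b; apply: le_trans (linear_row_bound (@amul_linear_r _ _ A a) b) _.
rewrite ler_wpM2r // mulr_suml; apply: ler_sum => j _.
exact: (linear_row_bound (@amul_linear_l _ _ A 'e_j) a).
Qed.

Lemma differentiable_eps (R : realType) (V W : normedModType R) (F : V -> W) (u : V) :
  differentiable F u -> forall e, 0 < e -> exists2 d, 0 < d &
    forall v, `|v| < d -> `|F (u + v) - F u - 'd F u v| <= e * `|v|.
Proof.
move=> dF e e0; have /eqaddoP/(_ e e0)/nbhs_normP[d /= d0 Hd] := diff_locally dF.
exists d => // v vd; have := Hd v; rewrite /= sub0r normrN => /(_ vd).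
by rewrite !fctE /= opprD addrA [v + u]addrC.
Qed.

Lemma amulDl (R : realType) (n : nat) (A : algebra_on R n) (a b c : 'rV[R]_n) :
  amul A (a + b) c = amul A a c + amul A b c.
Proof. by have := amul_linear_l A c 1 a b; rewrite !scale1r. Qed.

Lemma amulBl (R : realType) (n : nat) (A : algebra_on R n) (a b c : 'rV[R]_n) :
  amul A (a - b) c = amul A a c - amul A b c.
Proof. by apply/eqP; rewrite eq_sym subr_eq -amulDl subrK. Qed.

Lemma amulDr (R : realType) (n : nat) (A : algebra_on R n) (a b c : 'rV[R]_n) :
  amul A a (b + c) = amul A a b + amul A a c.
Proof. by rewrite ![amul A a _]amulC amulDl. Qed.

Lemma amulBr (R : realType) (n : nat) (A : algebra_on R n) (a b c : 'rV[R]_n) :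
  amul A a (b - c) = amul A a b - amul A a c.
Proof. by rewrite ![amul A a _]amulC amulBl. Qed.

(** Continuity of the differential on each of the finitely many basis vectors gives continuity in
    operator norm. *)
Lemma differential_continuous_eps (R : realType) (k n : nat) (U : set 'rV[R]_k)
    (phi : 'rV[R]_k -> 'rV[R]_n) :
  Ck_on U 2 phi -> forall p, U p -> forall e, 0 < e -> exists2 d, 0 < d &
    forall u, `|u - p| < d -> forall v, `|'d phi u v - 'd phi p v| <= e * `|v|.
Proof.
move=> [_ C1] p Up e e0.
have k1 : 0 < k.+1%:R :> R by [].
have ek : 0 < e / k.+1%:R by rewrite divr_gt0.
have : \forall u \near p, forall j : 'I_k,
    `|'d phi p 'e_j - 'd phi u 'e_j| < e / k.+1%:R.
  apply: (@filter_forall _ _ (fun (j : 'I_k) (u : 'rV[R]_k) =>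
    `|'d phi p 'e_j - 'd phi u 'e_j| < e / k.+1%:R) _ (nbhs_filter p)) => j.
  have [dj _] := C1 'e_j.
  by have /cvgrPdist_lt := differentiable_continuous (dj p Up); exact.
move=> /nbhs_normP[d /= d0 Hd]; exists d => // u up v.
have lin : linear (fun v => 'd phi u v - 'd phi p v).
  move: ('d phi u) ('d phi p) => g g' c x y.
  by rewrite (linearP g) (linearP g') scalerBr opprD addrACA.
apply: le_trans (linear_row_bound lin v) _; rewrite ler_wpM2r //.
apply: (@le_trans _ _ (\sum_(j < k) e / k.+1%:R)).
  by apply: ler_sum => j _; rewrite distrC ltW // Hd //= distrC.
rewrite sumr_const card_ord -[_ *+ k]mulr_natr mulrAC ler_pdivrMr // ler_wpM2l ?ltW //.
by rewrite ltr_nat.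
Qed.

(** The differential of [phi] is replaced by a family [D], which the next two lemmas know only
    through linearity and estimates. *)
Definition line_form (R : realType) (k n : nat) (A : algebra_on R n)
    (f : 'rV[R]_k -> 'rV[R]_n) (D : 'rV[R]_k -> 'rV[R]_k -> 'rV[R]_n)
    (i : 'I_n) (u v : 'rV[R]_k) : R :=
  amul A (f u) (D u v) ord0 i.

Lemma line_form_continuous (R : realType) (k n : nat) (A : algebra_on R n)
    (U : set 'rV[R]_k) (f : 'rV[R]_k -> 'rV[R]_n)
    (D : 'rV[R]_k -> 'rV[R]_k -> 'rV[R]_n) (i : 'I_n) :
  (forall u, linear (D u)) ->
  (forall p, U p -> forall e, 0 < e -> exists2 d, 0 < d &
    forall u, `|u - p| < d -> forall v, `|D u v - D p v| <= e * `|v|) ->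
  (forall p, U p -> {for p, continuous f}) ->
  continuous_form_on U (line_form A f D i).
Proof.
move=> Dlin Dc fc; have [C C0 HC] := amul_bound A.
have DM p : exists2 M, 0 <= M & forall v, `|D p v| <= M * `|v|.
  exists (\sum_(j < k) `|D p 'e_j|); first by apply: sumr_ge0.
  exact: linear_row_bound (Dlin p).
split=> [u c v v'|p Up|p Up e e0].
- by rewrite /line_form Dlin (amul_linear_r A (f u) c) !mxE.
- have [M M0 HM] := DM p; exists (C * `|f p| * M) => v.
  apply: le_trans (norm_entry_le _ _) _; apply: le_trans (HC _ _) _.
  by rewrite -[leRHS]mulrA ler_wpM2l // mulr_ge0.
have [M M0 HM] := DM p.
have n0 := normr_ge0 (f p).
have e2 : 0 < e / 2 by lra.
have K1 : 0 <= C * (`|f p| + 1) by rewrite mulr_ge0 //; lra.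
have [e1 [e10 _ He1]] := exists_small_factor K1 e2.
have [h [h0 h1 Hh]] := exists_small_factor (mulr_ge0 C0 M0) e2.
have [d1 d10 H1] := Dc p Up e1 e10.
have /cvgrPdist_lt/(_ h h0)/nbhs_normP[d2 /= d20 H2] :=
  fc p Up.
exists (Num.min d1 d2); first by rewrite lt_min d10.
move=> u; rewrite lt_min => /andP[/H1 {}H1 up] v.
have {}H2 : `|f u - f p| <= h by rewrite distrC ltW // H2 //= distrC.
(* The variation of the product is split into that of [D] and that of [f]. *)
have -> : line_form A f D i u v - line_form A f D i p v =
  (amul A (f u) (D u v - D p v) + amul A (f u - f p) (D p v)) ord0 i.
  by rewrite /line_form amulBr amulBl !mxE; ring.
apply: le_trans (norm_entry_le _ _) _; apply: le_trans (ler_normD _ _) _.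
have fu : `|f u| <= `|f p| + 1.
  rewrite -(subrK (f p) (f u)) addrC; apply: le_trans (ler_normD _ _) _.
  by rewrite lerD2l; lra.
have v0 := normr_ge0 v.
have B1 : `|amul A (f u) (D u v - D p v)| <= e / 2 * `|v|.
  apply: le_trans (HC _ _) _.
  apply: (@le_trans _ _ (C * (`|f p| + 1) * (e1 * `|v|))).
    by apply: ler_pM => //; [exact: mulr_ge0|exact: ler_wpM2l].
  by rewrite mulrA ler_wpM2r.
have B2 : `|amul A (f u - f p) (D p v)| <= e / 2 * `|v|.
  apply: le_trans (HC _ _) _.
  apply: (@le_trans _ _ (C * h * (M * `|v|))).
    by apply: ler_pM => //; [exact: mulr_ge0|exact: ler_wpM2l].
  by rewrite mulrA [C * h * M]mulrAC ler_wpM2r.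
by lra.
Qed.

Lemma line_form_closed (R : realType) (k n : nat) (A : algebra_on R n)
    (U : set 'rV[R]_k) (phi f f' : 'rV[R]_k -> 'rV[R]_n)
    (D : 'rV[R]_k -> 'rV[R]_k -> 'rV[R]_n) (i : 'I_n) :
  open U -> (forall u, linear (D u)) ->
  (forall p, U p -> forall e, 0 < e -> exists2 d, 0 < d &
    forall u, `|u - p| < d -> forall v, `|D u v - D p v| <= e * `|v|) ->
  (forall p, U p -> forall e, 0 < e -> exists2 d, 0 < d &
    forall v, `|v| < d -> `|phi (p + v) - phi p - D p v| <= e * `|v|) ->
  (forall p, U p -> forall e, 0 < e -> exists2 d, 0 < d &
    forall v, `|v| < d ->
      `|f (p + v) - f p - amul A (f' p) (D p v)| <= e * `|v|) ->
  closed_form_on U (line_form A f D i).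
Proof.
move=> oU Dlin Dc dphi df p Up e e0; have [C C0 HC] := amul_bound A.
have [M M0 HM] : exists2 M, 0 <= M & forall v, `|D p v| <= M * `|v|.
  exists (\sum_(j < k) `|D p 'e_j|); first by apply: sumr_ge0.
  exact: linear_row_bound (Dlin p).
have e2 : 0 < e / 2 by lra.
have K1 : 0 <= C * (M + 1) by rewrite mulr_ge0 //; lra.
have [e1 [e10 _ He1]] := exists_small_factor K1 e2.
have cn0 := normr_ge0 (f' p).
have K2 : 0 <= C * `|f' p| * (C * M) by rewrite !mulr_ge0.
have [h1 [h10 h11 Hh1]] := exists_small_factor K2 e2.
have [d1 d10 H1] := Dc p Up h1 h10.
have [d2 d20 H2] := df p Up e1 e10.
have /nbhs_normP[d3 /= d30 H3] : nbhs p U by exact: open_nbhs_nbhs.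
exists (Num.min d1 (Num.min d2 d3)); first by rewrite !lt_min d10 d20.
(* A primitive, up to first order at [p], of the expansion [f p + f' p * D p (u - p)] multiplied by
   the differential of [phi]; it depends on [p] alone, not on [u] or [h]. *)
pose G u := (amul A (f p) (phi u) + 2^-1 *: amul A (f' p)
  (amul A (D p (u - p)) (D p (u - p)))) ord0 i.
exists G => u; rewrite !lt_min => /and3P[/H1 {}H1 /H2 {}H2 up] h h0.
have Uu : U u by apply: H3; rewrite /= distrC.
have h2 : 0 < h / 2 by lra.
have K3 : 0 <= C * `|f p| by rewrite mulr_ge0.
have [h3 [h30 _ Hh3]] := exists_small_factor K3 h2.
have K4 : 0 <= C * `|f' p| * (C * M * M) by rewrite !mulr_ge0.
have [h4 [h40 _ Hh4]] := exists_small_factor K4 h2.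
have [d4 d40 H4] := dphi u Uu h3 h30.
exists (Num.min d4 h4); first by rewrite lt_min d40.
move=> v; rewrite lt_min => /andP[/H4 {}H4 vh4].
set c := f' p in H2 K2 K4 cn0 Hh1 Hh4 *.
(* Four errors: differentiability of [phi] at [u], differentiability of [f] at [p], variation of [D]
   from [p] to [u], and a term quadratic in [v]. The first and last are absorbed by [h], the middle
   two by [e |u - p|]. *)
have -> : G (u + v) - G u - line_form A f D i u v =
  (amul A (f p) (phi (u + v) - phi u - D u v)
   + amul A (f p - f u + amul A c (D p (u - p))) (D u v)
   + amul A c (amul A (D p (u - p)) (D p v - D u v))
   + 2^-1 *: amul A c (amul A (D p v) (D p v))) ord0 i.
  have -> : line_form A f D i u v = (amul A (f u) (D u v)) ord0 i by [].
  have DE : D p (u + v - p) = D p (u - p) + D p v.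
    by rewrite addrAC; have := Dlin p 1 (u - p) v; rewrite !scale1r.
  rewrite /G -/c DE !(amulBl, amulBr, amulDl, amulDr) -!(amulA A c).
  (* Commutativity merges the two cross terms of the square, which cancels the factor [1/2]. *)
  by rewrite (amulC A (D p v) (D p (u - p))) !mxE; field.
set T1 := amul A (f p) _; set T2 := amul A (_ + _) _; set T3 := amul A c (amul A (D p (u - p)) _).
set T4 := amul A c _.
apply: le_trans (norm_entry_le _ _) _.
have v0 := normr_ge0 v; have up0 := normr_ge0 (u - p).
have B1 : `|T1| <= h / 2 * `|v|.
  apply: le_trans (HC _ _) _; apply: (@le_trans _ _ (C * `|f p| * (h3 * `|v|))).
    by rewrite ler_wpM2l.
  by rewrite mulrA ler_wpM2r.
have DM : `|D u v| <= (M + 1) * `|v|.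
  rewrite -(subrK (D p v) (D u v)) addrC mulrDl; apply: le_trans (ler_normD _ _) _.
  by apply: lerD; [exact: HM|apply: le_trans (H1 v) _; rewrite ler_wpM2r].
have B2 : `|T2| <= e / 2 * `|u - p| * `|v|.
  apply: le_trans (HC _ _) _.
  have fE : `|f p - f u + amul A c (D p (u - p))| <= e1 * `|u - p|.
    move: H2; rewrite [p + _]addrC subrK -normrN.
    by rewrite opprD opprB opprK.
  apply: (@le_trans _ _ (C * (e1 * `|u - p|) * ((M + 1) * `|v|))).
    by apply: ler_pM => //; [exact: mulr_ge0|exact: ler_wpM2l].
  rewrite (_ : _ * _ = C * (M + 1) * e1 * (`|u - p| * `|v|)); last by ring.
  by rewrite -[leRHS]mulrA ler_wpM2r // mulr_ge0.
have B3 : `|T3| <= e / 2 * `|u - p| * `|v|.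
  apply: le_trans (HC _ _) _.
  apply: (@le_trans _ _ (C * `|c| * (C * (M * `|u - p|) * (h1 * `|v|)))).
    rewrite ler_wpM2l ?mulr_ge0 //; apply: le_trans (HC _ _) _.
    apply: ler_pM => //; [exact: mulr_ge0|exact: ler_wpM2l|].
    by rewrite distrC; exact: H1.
  rewrite (_ : _ * _ = C * `|c| * (C * M) * h1 * (`|u - p| * `|v|)); last by ring.
  by rewrite -[leRHS]mulrA ler_wpM2r // mulr_ge0.
have B4 : `|2^-1 *: T4| <= h / 2 * `|v|.
  rewrite normrZ ger0_norm ?invr_ge0 //; apply: (@le_trans _ _ `|T4|).
    by have := normr_ge0 T4; lra.
  apply: le_trans (HC _ _) _.
  apply: (@le_trans _ _ (C * `|c| * (C * (M * `|v|) * (M * `|v|)))).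
    rewrite ler_wpM2l ?mulr_ge0 //; apply: le_trans (HC _ _) _.
    apply: ler_pM => //; [exact: mulr_ge0|exact: ler_wpM2l].
  rewrite (_ : _ * _ = C * `|c| * (C * M * M) * `|v| * `|v|); last by ring.
  rewrite ler_wpM2r //; apply: le_trans Hh4.
  by rewrite ler_wpM2l // ltW.
apply: le_trans (ler_normD _ _) _; apply: (@le_trans _ _ (`|T1| + `|T2| + `|T3| + `|2^-1 *: T4|)).
  rewrite lerD2r; apply: le_trans (ler_normD _ _) _.
  by rewrite lerD2r ler_normD.
by rewrite mulrDl; lra.
Qed.

(** * Differentiable paths and the vanishing of the line integral *)

Lemma path_differentiable_velocity (R : realType) (k : nat) (t1 : R)
    (gamma : R -> 'rV[R]_k) :
  path_differentiable t1 gamma ->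
  has_velocity_on 0 t1 gamma (path_derivative t1 gamma).
Proof.
move=> dg s s0 st1 e e0.
have := dg s; rewrite in_itv /= s0 st1 => /(_ isT).
rewrite /path_derivative; set l := lim _ => /cvgrPdist_le/(_ e e0).
rewrite /within /= => /nbhs_ballP[d /= d0 H]; exists d => // y y0 yt1 ys.
(* The difference quotient is taken on a punctured neighbourhood, so [y = s] is treated apart. *)
have [->|yNs] := eqVneq y s.
  by rewrite !subrr scale0r subr0 !normr0 mulr0.
have h0 : y - s != 0 by rewrite subr_eq0.
have := H (y - s); rewrite -ball_normE /= sub0r normrN => /(_ ys h0).
rewrite addrC subrK in_itv /= y0 yt1 => /(_ isT) {}H.
have -> : gamma y - gamma s - (y - s) *: l =
    (y - s) *: - (l - (y - s)^-1 *: (gamma y - gamma s)).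
  by rewrite opprB scalerBr scalerA divff // scale1r.
by rewrite normrZ normrN mulrC ler_wpM2r.
Qed.

Lemma has_velocity_on_continuous (R : realType) (V : normedModType R) (a b : R)
    (gamma v : R -> V) :
  has_velocity_on a b gamma v -> {within `[a, b], continuous gamma}.
Proof.
move=> dg; apply/within_continuous_itvP => s as_ sb e e0.
have [d d0 Hd] := dg s as_ sb 1 ltr01.
have n0 := normr_ge0 (v s); have n2 : 0 < `|v s| + 1 by lra.
exists (Num.min d (e / (`|v s| + 1))); first by rewrite lt_min d0 divr_gt0.
move=> y ay yb; rewrite lt_min ltr_pdivlMr // => /andP[/(Hd y ay yb) {}Hd ys].
rewrite -(subrK ((y - s) *: v s) (gamma y - gamma s)).
apply: le_lt_trans (ler_normD _ _) _; rewrite normrZ.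
by move: Hd ys; rewrite mulrDr; lra.
Qed.

(* MathComp-Analysis puts both structures on matrices but does not declare their
   join, [completeNormedModType]. *)
HB.instance Definition _ (R : realType) (m n : nat) := Complete.on 'M[R]_(m, n).

(** The velocity of a merely differentiable path need not be Lebesgue integrable. Hence the two
    clauses: existence of the integral for continuous velocity, and its vanishing whenever it
    exists. *)
Theorem theorem3p1 (R : realType) (n k : nat) (A : algebra_on R n)
    (U : set 'rV[R]_k) (phi f : 'rV[R]_k -> 'rV[R]_n)
    (t1 : R) (gamma : R -> 'rV[R]_k) :
  open U -> simply_connected R U ->
  Ck_on U 2 phi ->
  phiA_differentiable U A phi f ->
  0 < t1 ->
  path_differentiable t1 gamma ->
  gamma @` `[0, t1] `<=` U ->
  gamma 0 = gamma t1 ->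
  ({within `[0, t1], continuous (path_derivative t1 gamma)} ->
     line_integrable t1 A phi f gamma) /\
  (line_integrable t1 A phi f gamma ->
     line_integral t1 A phi f gamma = 0).
Proof.
move=> oU [_ sc] C2 [df dphi [f' Hf']] t1_gt0 /path_differentiable_velocity dg gU g01.
pose w := line_form A f (fun u v => 'd phi u v).
have Dlin u : linear (fun v => 'd phi u v) by exact: linearP.
have Dc := differential_continuous_eps C2.
have wU i : continuous_form_on U (w i).
  apply: line_form_continuous => // p Up.
  exact: differentiable_continuous (df p Up).
have wcl i : closed_form_on U (w i).
  apply: (@line_form_closed _ _ _ _ _ phi f f') => // p Up e e0.
    exact: differentiable_eps (dphi p Up) e e0.
  have [d d0 Hd] := differentiable_eps (df p Up) e0; exists d => // v vd.
  (* The defining identity of differentiability relative to [phi] turns the estimate for ['d f p]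
     into the one required. *)
  by rewrite -Hf' //; exact: Hd.
have gU' t : 0 <= t -> t <= t1 -> U (gamma t).
  by move=> t0 tt1; apply: gU; exists t => //; rewrite /= in_itv /= t0.
have gc := has_velocity_on_continuous dg.
split=> [vc i|ig].
  apply: continuous_compact_integrable; first exact: segment_compact.
  exact: (continuous_form_path (wU i) gU' gc vc).
apply/rowP => i; rewrite !mxE.
have t1s s : 0 <= s <= 1 -> 0 <= t1 * s <= t1.
  move=> /andP[s0 s1]; have t0 := ltW t1_gt0.
  by apply/andP; split; [exact: mulr_ge0|exact: ler_piMr].
(* The loop is rescaled to [[0, 1]], where null-homotopies are defined; its base point appears below
   as [gamma (t1 * 0)]. *)
have [] := sc (fun s => gamma (t1 * s)).
- move/within_continuous_itvP : gc => gc; apply/within_continuous_itvP.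
  move=> s s0 s1 e e0; have s01 : 0 <= s <= 1 by rewrite s0.
  have /andP[ts0 ts1] := t1s s s01.
  have [d d0 Hd] := gc _ ts0 ts1 e e0.
  exists (d / t1); first by rewrite divr_gt0.
  move=> y y0 y1; rewrite ltr_pdivlMr // => ys.
  have y01 : 0 <= y <= 1 by rewrite y0.
  have /andP[ty0 ty1] := t1s y y01.
  by apply: Hd => //; rewrite -mulrBr normrM gtr0_norm // mulrC.
- move=> _ [s + <-]; rewrite /= in_itv /= => /t1s/andP[]; exact: gU'.
- by rewrite mulr0 mulr1.
move=> H [Hc HU Hbot Htop Hside].
have HB s : 0 <= s <= 1 -> H (s, 0) = gamma (t1 * s).
  by move=> s01; rewrite Hbot // in_itv.
have HT s : 0 <= s <= 1 -> H (s, 1) = gamma (t1 * 0).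
  by move=> s01; rewrite Htop // in_itv.
have HS t : 0 <= t <= 1 -> H (0, t) = gamma (t1 * 0) /\ H (1, t) = gamma (t1 * 0).
  by move=> t01; apply: Hside; rewrite in_itv.
exact: (@Rintegral_null_homotopic R 'rV[R]_k U _ _ _ _ _ _ (wU i) (wcl i) oU Hc HU HT HS
  t1_gt0 HB dg (ig i)).
Qed.
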